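(* Every tensor $C^*$-category $(\mathcal T,\otimes,\iota)$ has a natural structure of tensor $C(X^\iota)$-category, i.e. $\otimes$ is a $C(X^\iota)$-bifunctor.
   Context: A unital $C^*$-category $\mathcal T$ is a category with identity arrows $1_\rho$, whose arrow sets $(\rho,\sigma)$ are complex Banach spaces, with bilinear composition satisfying $\|t'\circ t\|\le\|t'\|\|t\|$ and an antilinear isometric involutive contravariant functor $*$, identical on objects, with $\|t^*\circ t\|=\|t\|^2$. A tensor $C^*$-category $(\mathcal T,\otimes,\iota)$ is a unital $C^*$-category with an associative, unital $C^*$-bifunctor $\otimes:\mathcal T\times\mathcal T\to\mathcal T$ (bilinear on arrows, compatible with composition and $*$) and an identity object $\iota$ with $\iota\otimes\rho=\rho\otimes\iota=\rho$ for every object $\rho$ and $t\otimes1_\iota=1_\iota\otimes t=t$ for every arrow $t$. Write $\rho\sigma:=\rho\otimes\sigma$; if $t\in(\rho,\sigma)$, $t'\in(\rho',\sigma')$ then $t\otimes t'\in(\rho\rho',\sigma\sigma')$. $(\iota,\iota)$ is a commutative unital $C^*$-algebra. $X^\iota$ is the (compact Hausdorff) spectrum of the commutative unital $C^*$-algebra $\{f\in(\iota,\iota): f\otimes1_\rho=1_\rho\otimes f\in(\rho,\rho)\text{ for every object }\rho\}$, which is identified with $C(X^\iota)$. For $X$ compact Hausdorff, a unital $C^*$-category is a $C(X)$-category if for every object $\rho$ there is given a non-degenerate (unital) $C^*$-algebra morphism $i_\rho:C(X)\to(\rho,\rho)$ such that $t\circ i_\rho(f)=i_\sigma(f)\circ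 t=:ft$ for all objects $\rho,\sigma$, all $t\in(\rho,\sigma)$ and $f\in C(X)$. That $\otimes$ is a $C(X)$-bifunctor means that it preserves the $C(X)$-action: $(ft)\otimes t'=t\otimes(ft')=f(t\otimes t')$ for all arrows $t,t'$ and $f\in C(X)$. *)

(* Defs.v *)
From HB Require Import structures.
From mathcomp Require Import all_boot all_order all_algebra complex.
From mathcomp Require Import all_classical all_reals all_analysis.

Set Implicit Arguments.
Unset Strict Implicit.
Unset Printing Implicit Defensive.

Import Order.TTheory GRing.Theory Num.Theory numFieldNormedType.Exports.

Local Open Scope classical_set_scope.
Local Open Scope complex_scope.
Local Open Scope ring_scope.

(* R[i]^o rather than R[i] carries the normed module structure, hence the
   topology, given by the modulus. *)
Notation Cplx R := ((R[i])^o).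

(* acomp t' t is t' o t.  Norms of elements of a normed module over R[i] are
   (nonnegative real) elements of R[i]. *)
Record cstarCat (R : realType) := CstarCat {
  obj :> Type;
  arr : obj -> obj -> completeNormedModType R[i];
  idarr : forall r, arr r r;
  acomp : forall r s t, arr s t -> arr r s -> arr r t;
  astar : forall r s, arr r s -> arr s r;
  acomp1r : forall r s (t : arr r s), acomp t (idarr r) = t;
  acomp1l : forall r s (t : arr r s), acomp (idarr s) t = t;
  acompA : forall q r s t (a : arr s t) (b : arr r s) (c : arr q r),
    acomp a (acomp b c) = acomp (acomp a b) c;
  acomp_linearl : forall r s t (z : R[i]) (a a' : arr s t) (b : arr r s),
    acomp (z *: a + a') b = z *: acomp a b + acomp a' b;
  acomp_linearr : forall r s t (z : R[i]) (a : arr s t) (b b' : arr r s),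
    acomp a (z *: b + b') = z *: acomp a b + acomp a b';
  acomp_norm : forall r s t (a : arr s t) (b : arr r s),
    `|acomp a b| <= `|a| * `|b|;
  astar_antilinear : forall r s (z : R[i]) (a b : arr r s),
    astar (z *: a + b) = z^* *: astar a + astar b;
  astar_isometric : forall r s (a : arr r s), `|astar a| = `|a|;
  astarK : forall r s (a : arr r s), astar (astar a) = a;
  astar_id : forall r, astar (idarr r) = idarr r;
  astar_comp : forall r s t (a : arr s t) (b : arr r s),
    astar (acomp a b) = acomp (astar b) (astar a);
  cstar_identity : forall r s (a : arr r s), `|acomp (astar a) a| = `|a| ^+ 2
}.

Arguments idarr {R T} r : rename.
Arguments acomp {R T r s t} _ _ : rename.
Arguments astar {R T r s} _ : rename.

(* Transport of arrows along equalities of objects: the tensor product is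
   strictly associative and unital, so that e.g. (t (x) t') (x) t'' and
   t (x) (t' (x) t'') live in arrow spaces that are only propositionally equal.
   All proofs of equality of objects are equal, so castarr does not depend on
   the choice of e and e'. *)
Definition castarr (R : realType) (T : cstarCat R) (r r' s s' : T)
    (e : r = r') (e' : s = s') (t : arr r s) : arr r' s' :=
  ecast x (arr r' x) e' (ecast x (arr x s) e t).

Record tensorCstarCat (R : realType) := TensorCstarCat {
  tcat :> cstarCat R;
  otens : tcat -> tcat -> tcat;
  ounit : tcat;
  otensA : forall r s t, otens (otens r s) t = otens r (otens s t);
  otens1l : forall r, otens ounit r = r;
  otens1r : forall r, otens r ounit = r;
  tens : forall r s r' s',
    arr r s -> arr r' s' -> arr (otens r r') (otens s s');
  tens_linearl : forall r s r' s' (z : R[i]) (a b : arr r s) (c : arr r' s'),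
    tens (z *: a + b) c = z *: tens a c + tens b c;
  tens_linearr : forall r s r' s' (z : R[i]) (a : arr r s) (b c : arr r' s'),
    tens a (z *: b + c) = z *: tens a b + tens a c;
  tens_id : forall r s, tens (idarr r) (idarr s) = idarr (otens r s);
  tens_comp : forall r s t r' s' t'
      (a : arr s t) (b : arr r s) (a' : arr s' t') (b' : arr r' s'),
    tens (acomp a b) (acomp a' b') = acomp (tens a a') (tens b b');
  tens_star : forall r s r' s' (a : arr r s) (a' : arr r' s'),
    astar (tens a a') = tens (astar a) (astar a');
  tensmA : forall r s r' s' r'' s''
      (a : arr r s) (a' : arr r' s') (a'' : arr r'' s''),
    castarr (otensA r r' r'') (otensA s s' s'') (tens (tens a a') a'')
    = tens a (tens a' a'');
  tensm1l : forall r s (a : arr r s),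
    castarr (otens1l r) (otens1l s) (tens (idarr ounit) a) = a;
  tensm1r : forall r s (a : arr r s),
    castarr (otens1r r) (otens1r s) (tens a (idarr ounit)) = a
}.

Arguments otens {R T} r s : rename.
Arguments ounit {R} T : rename.
Arguments otens1l {R T} r : rename.
Arguments otens1r {R T} r : rename.
Arguments tens {R T r s r' s'} _ _ : rename.

Section ContinuousFunctions.
Context (K : numClosedFieldType) (X : topologicalType).

Definition cont_pred : {pred X -> K^o} := mem [set g : X -> K^o | continuous g].

Lemma cont_subring_closed : subring_closed cont_pred.
Proof.
split=> [|f g /set_mem cf /set_mem cg|f g /set_mem cf /set_mem cg];
  apply/mem_set => x.
- exact: cvg_cst.
- by apply: cvgB; [exact: cf|exact: cg].
- by apply: cvgM; [exact: cf|exact: cg].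
Qed.

Lemma cont_submod_closed : submod_closed cont_pred.
Proof.
split=> [|a f g /set_mem cf /set_mem cg]; apply/mem_set => x.
- exact: cvg_cst.
- by apply: cvgD; [apply: cvgZr; exact: cf|exact: cg].
Qed.

Lemma cont_conj (g : X -> K^o) :
  continuous g -> continuous ((fun x => (g x)^*) : X -> K^o).
Proof.
move=> cg x; apply/cvgrPdist_lt => e e0.
have /cvgrPdist_lt/(_ e e0) := cg x.
by apply: filterS => y; rewrite -rmorphB norm_conjC.
Qed.

HB.instance Definition _ := GRing.isSubringClosed.Build
  (X -> K^o) cont_pred cont_subring_closed.
HB.instance Definition _ := GRing.isSubmodClosed.Build
  K (X -> K^o) cont_pred cont_submod_closed.

Record contFun := ContFun {
  contFun_val :> X -> K^o;
  contFunP : contFun_val \in cont_pred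
}.

HB.instance Definition _ := [isSub for contFun_val].
HB.instance Definition _ := [Choice of contFun by <:].
HB.instance Definition _ :=
  GRing.SubChoice_isSubComPzRing.Build _ _ contFun cont_subring_closed.
HB.instance Definition _ := [SubZmodule_isSubLmodule of contFun by <:].

Definition contFun_conj (g : contFun) : contFun :=
  ContFun (mem_set (cont_conj (set_mem (contFunP g)))).

End ContinuousFunctions.

Section CXCategory.
Context (R : realType) (T : cstarCat R).

Definition unital_star_morphism (X : topologicalType) (r : T)
    (i : contFun R[i] X -> arr r r) : Prop :=
  [/\ linear i,
      forall f g, i (f * g) = acomp (i f) (i g),
      forall f, i (contFun_conj f) = astar (i f)
    & i 1 = idarr r].

Definition is_CX_category (X : topologicalType)
    (i : forall r : T, contFun R[i] X -> arr r r) : Prop :=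
  [/\ compact [set: X],
      hausdorff_space X,
      forall r, unital_star_morphism (i r)
    & forall r s (t : arr r s) f, acomp t (i r f) = acomp (i s f) t].

End CXCategory.

(* The action ft := i_s(f) o t for t in (r, s). *)
Definition CX_act (R : realType) (T : cstarCat R) (X : topologicalType)
    (i : forall r : T, contFun R[i] X -> arr r r) (r s : T)
    (f : contFun R[i] X) (t : arr r s) : arr r s :=
  acomp (i s f) t.

Definition is_tensor_CX_category (R : realType) (T : tensorCstarCat R)
    (X : topologicalType) (i : forall r : T, contFun R[i] X -> arr r r) : Prop :=
  is_CX_category i /\
  forall (r s r' s' : T) (t : arr r s) (t' : arr r' s') (f : contFun R[i] X),
    tens (CX_act i f t) t' = CX_act i f (tens t t') /\
    tens t (CX_act i f t') = CX_act i f (tens t t').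

Section Spectrum.
Context (R : realType) (T : tensorCstarCat R).
Local Notation I := (ounit T).

(* f (x) 1_r and 1_r (x) f as elements of (r, r). *)
Definition tens_idr (f : arr I I) (r : T) : arr r r :=
  castarr (otens1l r) (otens1l r) (tens f (idarr r)).

Definition tens_idl (f : arr I I) (r : T) : arr r r :=
  castarr (otens1r r) (otens1r r) (tens (idarr r) f).

Definition central_pred : {pred arr I I} :=
  mem [set f : arr I I | forall r : T, tens_idr f r = tens_idl f r].

Lemma castarr_linear (r r' s s' : T) (e : r = r') (e' : s = s') :
  linear (@castarr R T r r' s s' e e').
Proof. by case: r' / e; case: s' / e'. Qed.

Lemma castarr_comp (r r' : T) (e : r = r') (a b : arr r r) :
  castarr e e (acomp a b) = acomp (castarr e e a) (castarr e e b).
Proof. by case: r' / e. Qed.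

Lemma castarr_idarr (r r' : T) (e : r = r') :
  castarr e e (idarr r) = idarr r'.
Proof. by case: r' / e. Qed.

Lemma tens_idr_linear (r : T) : linear (tens_idr ^~ r).
Proof. by move=> z a b; rewrite /tens_idr tens_linearl castarr_linear. Qed.

Lemma tens_idl_linear (r : T) : linear (tens_idl ^~ r).
Proof. by move=> z a b; rewrite /tens_idl tens_linearr castarr_linear. Qed.

Lemma central_submod_closed : submod_closed central_pred.
Proof.
have lin0 (U : lmodType R[i]) (V : lmodType R[i]) (h : U -> V) :
    linear h -> h 0 = 0.
  by move=> hl; have := hl (-1) 0 0; rewrite scaler0 addr0 scaleN1r addNr.
split=> [|z a b /set_mem ca /set_mem cb]; apply/mem_set => r.
- by rewrite (lin0 _ _ _ (tens_idr_linear r)) (lin0 _ _ _ (tens_idl_linear r)).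
- by rewrite tens_idr_linear tens_idl_linear ca cb.
Qed.

Lemma central_id : idarr I \in central_pred.
Proof.
by apply/mem_set => r; rewrite /tens_idr /tens_idl !tens_id !castarr_idarr.
Qed.

Lemma central_comp (a b : arr I I) :
  a \in central_pred -> b \in central_pred -> acomp a b \in central_pred.
Proof.
move=> /set_mem ca /set_mem cb; apply/mem_set => r.
rewrite /tens_idr /tens_idl -[idarr r]acomp1r !tens_comp !castarr_comp.
by congr acomp; [exact: ca|exact: cb].
Qed.

HB.instance Definition _ := GRing.isSubmodClosed.Build
  R[i] (arr I I) central_pred central_submod_closed.

Record central := Central {
  central_val :> arr I I;
  centralP : central_val \in central_pred
}.

HB.instance Definition _ := [isSub for central_val].
HB.instance Definition _ := [Choice of central by <:].
HB.instance Definition _ := [SubChoice_isSubLmodule of central by <:].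

Definition central1 : central := Central central_id.

Definition central_mul (f g : central) : central :=
  Central (central_comp (centralP f) (centralP g)).

Definition character : set {ptws central -> Cplx R} :=
  [set chi | [/\ linear (chi : central -> Cplx R), chi central1 = 1
               & forall f g, chi (central_mul f g) = chi f * chi g]].

(* set_type carries the topology induced from the pointwise one, that is, the
   weak* topology. *)
Definition spectrum : topologicalType := set_type character.

Definition gelfand_fun (f : central) (chi : spectrum) : Cplx R :=
  (set_val chi : central -> Cplx R) f.

Lemma gelfand_fun_continuous (f : central) : continuous (gelfand_fun f).
Proof.
move=> chi; apply: (@continuous_comp spectrum {ptws central -> Cplx R} _
  set_val (fun g => g f)).
  exact: initial_continuous.
exact: proj_continuous.
Qed.

Definition gelfand (f : central) : contFun R[i] spectrum :=
  ContFun (mem_set (@gelfand_fun_continuous f)).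

End Spectrum.

(* Main.v *)
(* The point is Gelfand duality for the algebra C of central elements, after
   which f acts on (r, r) as g (x) 1_r, where g in C has Gelfand transform f;
   that this respects tensor products on both sides is the centrality of g.

   Gelfand duality is proved without spectral theory.  The self-adjoint part of
   a commutative unital C*-algebra is a real Banach algebra with
   |a|^2 <= |a^2 + b^2|, because |a| <= |a + ib|.  There 1 - x is a square for
   |x| < 1, so that the closure of the squares is a cone of positive elements,
   which determines the norm.  A maximal preordering containing this cone is
   total, and the cut it defines in the reals is a character; hence an element
   that is positive at all characters is positive, and the norm is the supremum
   over the characters.  Surjectivity is the lattice form of the
   Stone-Weierstrass theorem.  C itself is complete because *-morphisms
   from (iota, iota), such as f |-> f (x) 1_r, are contractive. *)
Require Import Defs.
From HB Require Import structures.
From mathcomp Require Import all_boot all_order all_algebra complex.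
From mathcomp Require Import all_classical all_reals all_analysis.
From mathcomp Require Import ring lra.

Set Implicit Arguments.
Unset Strict Implicit.
Unset Printing Implicit Defensive.

Import Order.TTheory GRing.Theory Num.Theory numFieldNormedType.Exports.

Local Open Scope classical_set_scope.
Local Open Scope complex_scope.
Local Open Scope ring_scope.

(** * Real commutative C*-algebras *)

(** Scalars enter through a ring morphism rather than a module structure, which puts identities
    mixing scalars and elements within reach of [ring]. The axiom [rnrm_sqrD] is the trace of the
    C*-identity on self-adjoint elements; with [b = 0] it yields N(a)^2 <= N(a^2). The zero ring is
    allowed, since (iota, iota) may vanish; hence only N(1) <= 1 below. *)
Record realCstarAlg (R : realType) := RealCstarAlg {
  rcar :> comPzRingType;
  rcst : {rmorphism R -> rcar};
  rnrm : rcar -> R;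
  rnrmD : forall a b, rnrm (a + b) <= rnrm a + rnrm b;
  rnrmZ : forall r a, rnrm (rcst r * a) = `|r| * rnrm a;
  rnrmM : forall a b, rnrm (a * b) <= rnrm a * rnrm b;
  rnrm0_eq0 : forall a, rnrm a = 0 -> a = 0;
  rnrm_sqrD : forall a b, rnrm a ^+ 2 <= rnrm (a ^+ 2 + b ^+ 2);
  rnrm_complete : forall u : nat -> rcar,
    (forall e, 0 < e -> exists n0, forall m n, (n0 <= m)%N -> (n0 <= n)%N ->
       rnrm (u m - u n) < e) ->
    exists l, forall e, 0 < e -> exists n0, forall n, (n0 <= n)%N ->
       rnrm (u n - l) < e
}.

Lemma geometric_small (R : realType) (C q e : R) :
  0 <= q -> q < 1 -> 0 < e -> exists n0, forall n, (n0 <= n)%N ->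
    C * q ^+ n < e.
Proof.
move=> q0 q1 e0.
have [C0|C0] := leP C 0.
  exists 0%N => n _; apply: le_lt_trans e0.
  by rewrite mulr_le0_ge0// exprn_ge0.
have /cvgrPdist_lt/(_ (e / C)) : q ^+ n @[n --> \oo] --> 0.
  by apply: cvg_expr; rewrite ger0_norm.
rewrite divr_gt0// => /(_ isT)[n0 _ n0P]; exists n0 => n n0n.
have /= := n0P n n0n.
by rewrite sub0r normrN ger0_norm ?exprn_ge0// ltr_pdivlMr// mulrC.
Qed.

Section RealCstarAlg.
Context (R : realType) (B : realCstarAlg R).
Local Notation c := (@rcst R B).
Local Notation N := (@rnrm R B).
Implicit Types (a b p x y : B) (r s t e : R).

Lemma rnrm0 : N 0 = 0.
Proof. by have := rnrmZ 0 (0 : B); rewrite rmorph0 mul0r normr0 mul0r. Qed.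

Lemma rnrmN a : N (- a) = N a.
Proof. by have := rnrmZ (-1) a; rewrite rmorphN1 mulN1r normrN1 mul1r. Qed.

Lemma rnrm_ge0 a : 0 <= N a.
Proof. by have := rnrmD a (- a); rewrite subrr rnrm0 rnrmN; lra. Qed.

Lemma rnrmB a b : N (a - b) <= N a + N b.
Proof. by rewrite -(rnrmN b) rnrmD. Qed.

Lemma rnrm1 : N 1 <= 1.
Proof.
have := @rnrm_sqrD R B 1 0; rewrite expr0n addr0 expr1n expr2.
by have := rnrm_ge0 1; nra.
Qed.

Lemma rnrm_cst r : N (c r) <= `|r|.
Proof.
by have := rnrmZ r (1 : B); rewrite mulr1 => ->; rewrite ler_piMr ?rnrm1.
Qed.

Lemma rnrm_sqr a : N (a ^+ 2) = N a ^+ 2.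
Proof.
apply/eqP; rewrite eq_le expr2 rnrmM/=.
by have := rnrm_sqrD a 0; rewrite expr0n addr0 -expr2.
Qed.

(** Banach's fixed point theorem on a ball; it replaces power series in the construction of square
    roots and inverses. *)
Lemma contraction_fixpoint (F : B -> B) (rho q : R) :
    0 <= rho -> 0 <= q -> q < 1 -> (forall y, N y <= rho -> N (F y) <= rho) ->
    (forall y z, N y <= rho -> N z <= rho -> N (F y - F z) <= q * N (y - z)) ->
  exists2 y, N y <= rho & F y = y.
Proof.
move=> rho0 q0 q1 Frho Fq; pose u n := iter n F 0.
have iterrho n y : N y <= rho -> N (iter n F y) <= rho.
  by move=> yrho; elim: n => //= n IH; exact: Frho.
have urho n : N (u n) <= rho by apply: iterrho; rewrite rnrm0.
(* Both terms are images under the n-th iterate of [F], of [u k] and of 0, which are at distance at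
   most [rho]; no geometric series has to be summed. *)
have uk n k : N (u (n + k)%N - u n) <= rho * q ^+ n.
  rewrite /u iterD -/(u k); elim: n => [|n IH] /=.
    by rewrite subr0 expr0 mulr1.
  apply: le_trans (Fq _ _ (iterrho n _ (urho k)) (urho n)) _.
  by rewrite exprS mulrCA ler_wpM2l.
have cauchy : forall e, 0 < e -> exists n0, forall m n, (n0 <= m)%N ->
    (n0 <= n)%N -> N (u m - u n) < e.
  move=> e e0; have e20 : 0 < e / 2 by rewrite divr_gt0.
  have [n0 n0P] := geometric_small rho q0 q1 e20.
  exists n0 => m n n0m n0n.
  have := uk n0 (m - n0)%N; rewrite subnKC// => um.
  have := uk n0 (n - n0)%N; rewrite subnKC// => un.
  have := rnrmB (u m - u n0) (u n - u n0); rewrite opprB addrA subrK.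
  by have := n0P n0 (leqnn n0); lra.
have [l lP] := rnrm_complete cauchy.
have Nl : N l <= rho.
  apply/ler_addgt0Pr => e /lP[n /(_ n (leqnn n)) nP].
  have := rnrmB (u n) (u n - l); rewrite opprB addrC subrK.
  by have := urho n; lra.
exists l => //; apply/eqP; rewrite -subr_eq0; apply/eqP/rnrm0_eq0/eqP.
rewrite eq_le rnrm_ge0 andbT; apply/ler_addgt0Pr => e e0; rewrite add0r.
have /lP[n nP] : 0 < e / 2 by rewrite divr_gt0.
have n1 := nP n (leqnn n); have n2 := nP n.+1 (leqnSn n).
have := Fq _ _ (urho n) Nl; rewrite -/(u n.+1) => n3.
have := rnrmB (u n.+1 - l) (F (u n) - F l); rewrite opprB addrC.
have -> : F l - F (u n) + (u n.+1 - l) = F l - l by rewrite /u /=; ring.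
move=> n4; have : q * N (u n - l) <= N (u n - l).
  by rewrite ler_piMl ?rnrm_ge0 ?ltW.
lra.
Qed.

(* The order cone: in terms of the spectrum, [0, 2M] is the ball of radius M
   around M. *)
Definition rpos a := exists M, N (c M - a) <= M.

Lemma rpos_upper a M : N a <= M -> rpos (c M - a).
Proof. by move=> aM; exists M; rewrite opprB addrC subrK. Qed.

Lemma rpos_addcst a t : N a <= t -> rpos (a + c t).
Proof.
by rewrite -rnrmN addrC => at_; rewrite -[a]opprK; exact: rpos_upper.
Qed.

Lemma rpos_cst r : 0 <= r -> rpos (c r).
Proof. by move=> r0; exists r; rewrite subrr rnrm0. Qed.

Lemma rpos0 : rpos 0. Proof. by rewrite -(rmorph0 c); exact: rpos_cst. Qed.

Lemma rpos1 : rpos 1. Proof. by rewrite -(rmorph1 c); exact: rpos_cst. Qed.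

Lemma rposZ r a : 0 <= r -> rpos a -> rpos (c r * a).
Proof.
move=> r0 [M aM]; exists (r * M).
by rewrite rmorphM -mulrBr rnrmZ ger0_norm// ler_wpM2l.
Qed.

Lemma half_half : c 2^-1 + c 2^-1 = 1.
Proof. by rewrite -rmorphD -[RHS](rmorph1 c); congr (c _); lra. Qed.

(** With y = 1 - z the equation y^2 = 1 - x becomes z = (x + z^2)/2, whose right side maps the ball
    of radius N x into itself and contracts it by the factor N x. As N z <= 1, the root 1 - z is
    positive. *)
Lemma sqrt1B x : N x < 1 -> exists2 y, y ^+ 2 = 1 - x & rpos y.
Proof.
move=> x1; have x0 := rnrm_ge0 x.
have half0 : 0 <= 2^-1 :> R by rewrite invr_ge0.
pose F z := c 2^-1 * (x + z ^+ 2).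
have [| |z zx Fz] := @contraction_fixpoint F (N x) (N x) x0 x0 x1.
- move=> y yx; rewrite rnrmZ ger0_norm//.
  have := rnrmD x (y ^+ 2); rewrite rnrm_sqr; have := rnrm_ge0 y; nra.
- move=> y z yx zx; rewrite -mulrBr.
  have -> : x + y ^+ 2 - (x + z ^+ 2) = (y + z) * (y - z) by ring.
  rewrite rnrmZ ger0_norm//.
  have := rnrmM (y + z) (y - z); have := rnrmD y z.
  have := rnrm_ge0 (y - z); nra.
exists (1 - z); last first.
  by rewrite -(rmorph1 c); apply: rpos_upper; exact: le_trans zx (ltW x1).
have h := half_half.
have : z + z = x + z ^+ 2.
  by rewrite -{1 2}Fz /F -mulrDl half_half mul1r.
move=> zz; have -> : (1 - z) ^+ 2 = 1 - (z + z) + z ^+ 2 by ring.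
by rewrite zz; ring.
Qed.

Lemma inv1B x : N x < 1 -> exists y, (1 - x) * y = 1.
Proof.
move=> x1; have x0 := rnrm_ge0 x.
(* This radius solves rho = 1 + N x * rho, so y |-> 1 + x y preserves its ball; the fixed point is
   the sum of the Neumann series. *)
have rho0 : 0 < (1 - N x)^-1 by rewrite invr_gt0 subr_gt0.
have rhoE : 1 + N x * (1 - N x)^-1 = (1 - N x)^-1.
  by field; rewrite subr_eq0 gt_eqF.
have [| |y _ yP] :=
  @contraction_fixpoint (fun y => 1 + x * y) _ _ (ltW rho0) x0 x1.
- move=> y yrho; have := rnrmD 1 (x * y); have := rnrmM x y; have := rnrm1.
  have := rnrm_ge0 y; nra.
- move=> y z _ _; apply: le_trans (rnrmM _ _).
  by rewrite le_eqVlt; apply/orP; left; apply/eqP; congr N; ring.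
by exists y; rewrite mulrBl mul1r -{1}yP; ring.
Qed.

Lemma cstV r : r != 0 -> c r * c r^-1 = 1.
Proof. by move=> r0; rewrite -rmorphM divff// rmorph1. Qed.

Lemma sqrtB x r : N x < r -> exists2 y, y ^+ 2 = c r - x & rpos y.
Proof.
move=> xr; have r0 : 0 < r by apply: le_lt_trans xr; exact: rnrm_ge0.
have [|y yP y0] := @sqrt1B (c r^-1 * x).
  by rewrite rnrmZ gtr0_norm ?invr_gt0// mulrC ltr_pdivrMr// mul1r.
exists (c (Num.sqrt r) * y); last exact: rposZ (sqrtr_ge0 r) y0.
rewrite exprMn yP -rmorphXn sqr_sqrtr ?ltW//.
by have := cstV (lt0r_neq0 r0); move: (c r) (c r^-1) => u v uv; ring: uv.
Qed.

Lemma invB x r : N x < r -> exists y, (c r - x) * y = 1.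
Proof.
move=> xr; have r0 : 0 < r by apply: le_lt_trans xr; exact: rnrm_ge0.
have [|y yP] := @inv1B (c r^-1 * x).
  by rewrite rnrmZ gtr0_norm ?invr_gt0// mulrC ltr_pdivrMr// mul1r.
exists (c r^-1 * y); rewrite -yP.
by have := cstV (lt0r_neq0 r0); move: (c r) (c r^-1) => u v uv; ring: uv.
Qed.

Lemma rposD a b : rpos a -> rpos b -> rpos (a + b).
Proof.
move=> [M aM] [M' bM']; exists (M + M'); rewrite rmorphD.
have -> : c M + c M' - (a + b) = (c M - a) + (c M' - b) by ring.
by have := rnrmD (c M - a) (c M' - b); lra.
Qed.

(** The shift makes room for the strict bound of [sqrtB]: a + e = (M + e) - (M - a) with N(M - a) <=
    M < M + e. *)
Lemma rpos_sqrt a e : 0 < e -> rpos a ->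
  exists2 y, y ^+ 2 = a + c e & rpos y.
Proof.
move=> e0 [M aM]; have [|y yP y0] := @sqrtB (c M - a) (M + e); first by lra.
by exists y => //; rewrite yP rmorphD; ring.
Qed.

(** M - a^2 is itself a square k^2, and k^2 + a^2 = M, so [rnrm_sqrD] bounds N(k)^2. *)
Lemma sqr_upper a M : N a ^+ 2 < M -> N (c M - a ^+ 2) <= M.
Proof.
move=> aM; have M0 : 0 <= M by have := sqr_ge0 (N a); lra.
move: aM; rewrite -rnrm_sqr => /sqrtB[k kP _].
have := rnrm_sqrD k a; rewrite -kP rnrm_sqr.
have -> : k ^+ 2 + a ^+ 2 = c M by rewrite kP; ring.
by have := rnrm_cst M; rewrite ger0_norm//; lra.
Qed.

Lemma rpos_sqr a : rpos (a ^+ 2).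
Proof. by exists (N a ^+ 2 + 1); apply: sqr_upper; lra. Qed.

(** Positivity provides some bound, whereas here every M > N a serves; this uniformity makes the
    cone closed. For small d the element a + d is a square of norm below M, so [sqr_upper] applies,
    and d tends to 0. *)
Lemma rpos_upper_bound a M : rpos a -> N a < M -> N (c M - a) <= M.
Proof.
move=> a0 aM; apply/ler_addgt0Pr => e e0.
pose d := Num.min (e / 2) ((M - N a) / 2).
have d0 : 0 < d by rewrite lt_min !divr_gt0// subr_gt0.
have de : d <= e / 2 by rewrite ge_min lexx.
have dM : d <= (M - N a) / 2 by rewrite ge_min lexx orbT.
have [y yP _] := rpos_sqrt d0 a0.
have := rnrm_cst d; rewrite gtr0_norm// => cd.
have : N (y ^+ 2) < M by rewrite yP; have := rnrmD a (c d); lra.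
rewrite rnrm_sqr => /sqr_upper; rewrite yP.
have := rnrmD (c M - (a + c d)) (c d).
have -> : c M - (a + c d) + c d = c M - a by ring.
by lra.
Qed.

Lemma rpos_closed a : (forall e, 0 < e -> rpos (a + c e)) -> rpos a.
Proof.
(* A single bound for all a + d with d <= 1, whose norms stay below N a + 2. *)
move=> aP; exists (N a + 2); apply/ler_addgt0Pr => e e0.
pose d := Num.min e 1.
have d0 : 0 < d by rewrite lt_min e0 ltr01.
have de : d <= e by rewrite ge_min lexx.
have d1 : d <= 1 by rewrite ge_min lexx orbT.
have := rnrm_cst d; rewrite gtr0_norm// => cd.
have : N (a + c d) < N a + 2 by have := rnrmD a (c d); lra.
move=> /(rpos_upper_bound (aP _ d0)).
have := rnrmD (c (N a + 2) - (a + c d)) (c d).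
have -> : c (N a + 2) - (a + c d) + c d = c (N a + 2) - a by ring.
by lra.
Qed.

Lemma rposM a b : rpos a -> rpos b -> rpos (a * b).
Proof.
move=> a0 b0; apply: rpos_closed => e e0.
(* The product is expressed as ab = (a + d)(b + d) - d(a + b) - d^2, where a + d and b + d are
   squares. [K] dominates a + b, and [d] is so small that d(K + d) <= e. *)
pose K := N (a + b) + 1.
have K0 : 0 < K by rewrite ltr_wpDl ?rnrm_ge0.
pose d := Num.min 1 (e / (K + 1)).
have d0 : 0 < d by rewrite lt_min ltr01 divr_gt0// addr_gt0.
have d1 : d <= 1 by rewrite ge_min lexx.
have dK : d * (K + 1) <= e.
  by rewrite -ler_pdivlMr; [rewrite ge_min lexx orbT|lra].
have [y yP _] := rpos_sqrt d0 a0; have [z zP _] := rpos_sqrt d0 b0.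
have -> : a * b + c e = (y * z) ^+ 2 + c d * (c K - (a + b))
    + c (e - d * (K + d)).
  by rewrite exprMn yP zP !(rmorphD, rmorphB, rmorphM, rmorphN); ring.
apply: rposD; first apply: rposD.
- exact: rpos_sqr.
- by apply: rposZ (ltW d0) _; apply: rpos_upper; rewrite /K; lra.
- by apply: rpos_cst; nra.
Qed.

Lemma rpos_inv a e : 0 < e -> rpos a -> exists y, (a + c e) * y = 1.
Proof.
move=> e0 [M aM]; have [|y yP] := @invB (c M - a) (M + e); first by lra.
by exists y; rewrite -yP rmorphD; ring.
Qed.

(** The product t^2 - a^2 of the two positive elements is positive, so t^2 + e - a^2 is a square,
    and [rnrm_sqrD] gives N(a)^2 <= N(t^2 + e). *)
Lemma rpos_norm a t : 0 <= t -> rpos (c t - a) -> rpos (c t + a) -> N a <= t.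
Proof.
move=> t0 h1 h2; rewrite -(ler_pXn2r (n := 2)) ?nnegrE ?rnrm_ge0//.
apply/ler_addgt0Pr => e e0.
have [y yP _] := rpos_sqrt e0 (rposM h1 h2).
apply: le_trans (rnrm_sqrD a y) _.
have -> : a ^+ 2 + y ^+ 2 = c (t ^+ 2 + e).
  by rewrite yP rmorphD rmorphXn; ring.
by apply: le_trans (rnrm_cst _) _; rewrite ger0_norm// addr_ge0 ?sqr_ge0 ?ltW.
Qed.

(* A strict Positivstellensatz: the relation says that -1 belongs to the
   preordering generated by -a. *)
Lemma rpos_of_cert a p q : rpos p -> rpos q -> a * q = 1 + p -> rpos a.
Proof.
move=> p0 q0 aq.
pose M := N p + 1; have M0 : 0 < M by rewrite ltr_wpDl ?rnrm_ge0.
have Mp : rpos (c M - p) by apply: rpos_upper; rewrite /M; lra.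
have ap : rpos (a * (1 + p)).
  by rewrite -aq mulrA -expr2; apply: rposM => //; exact: rpos_sqr.
pose th := M / (1 + M).
have M10 : 0 < 1 + M by lra.
have th0 : 0 <= th by rewrite divr_ge0// ltW.
have th1 : th < 1 by rewrite ltr_pdivrMr// mul1r; lra.
have thE : th * (1 + M) = M by rewrite divfK// gt_eqF.
(* The sum (a + k)(M - p) + a(1 + p) + k p of positive elements equals (1 + M)(a + k th). The shift
   thus shrinks by the factor [th] < 1, and iteration from k = N a drives it to 0. *)
have step k : 0 <= k -> rpos (a + c k) -> rpos (a + c (k * th)).
  move=> k0 ak.
  have -> : a + c (k * th) = c (1 + M)^-1 *
      ((a + c k) * (c M - p) + a * (1 + p) + c k * p).
    have -> : (a + c k) * (c M - p) + a * (1 + p) + c k * p =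
      c (1 + M) * (a + c (k * th)).
      have thM : c th * c M = c M - c th.
        by rewrite -rmorphM -rmorphB; congr (c _); lra.
      rewrite [c (k * th)]rmorphM [c (1 + M)]rmorphD rmorph1.
      by move: (c th) (c M) thM => u v uv; ring: uv.
    by rewrite mulrA [c _ * c _]mulrC cstV ?mul1r// gt_eqF.
  apply: rposZ; first by rewrite invr_ge0 ltW.
  by apply: rposD; [apply: rposD => //; exact: rposM|exact: rposZ].
have iter_step n : rpos (a + c (N a * th ^+ n)).
  elim: n => [|n IH]; first by rewrite mulr1; exact: rpos_addcst.
  rewrite exprSr mulrA; apply: step => //.
  by rewrite mulr_ge0 ?rnrm_ge0 ?exprn_ge0.
apply: rpos_closed => e e0.
have [n nP] := geometric_small (N a) th0 th1 e0.
have -> : a + c e = a + c (N a * th ^+ n) + c (e - N a * th ^+ n).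
  by rewrite rmorphB; ring.
by apply: rposD => //; apply: rpos_cst; rewrite subr_ge0 ltW// nP.
Qed.

End RealCstarAlg.

(** * Characters from maximal preorderings *)

Section RealCharacters.
Context (R : realType) (B : realCstarAlg R).
Local Notation c := (@rcst R B).
Local Notation N := (@rnrm R B).
Implicit Types (a b : B) (P Q : set B) (chi : B -> R).

Definition rcharacter chi : Prop :=
  [/\ forall r, chi (c r) = r, {morph chi : a b / a + b}
    & {morph chi : a b / a * b}].

Definition preordering P : Prop :=
  [/\ @rpos R B `<=` P, forall a b, P a -> P b -> P (a + b),
      forall a b, P a -> P b -> P (a * b) & ~ P (-1)].

Lemma maximal_preordering P : preordering P ->
  exists Q, [/\ preordering Q, P `<=` Q
    & forall Q', preordering Q' -> Q `<=` Q' -> Q' `<=` Q].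
Proof.
move=> prP.
(* Joining [P] to every member takes care of the empty chain, whose union is empty. *)
have [F FP Ftot|Q [prQ maxQ]] := @Zorn_bigcup B [set Q | preordering (Q `|` P)].
  have posP : @rpos R B `<=` P by case: prP.
  have in2 a b : (\bigcup_(X in F) X `|` P) a -> (\bigcup_(X in F) X `|` P) b ->
      exists Z, [/\ preordering Z, Z a, Z b & Z `<=` \bigcup_(X in F) X `|` P].
    have sub X : F X -> X `|` P `<=` \bigcup_(X in F) X `|` P.
      by move=> FX; apply: setSU; exact: bigcup_sup.
    move=> [[X FX Xa]|Pa] [[Y FY Yb]|Pb].
    - have [XY|YX] := Ftot _ _ FX FY.
        by exists (Y `|` P); split; [exact: FP|left; exact: XY|left|exact: sub].
      by exists (X `|` P); split; [exact: FP|left|left; exact: YX|exact: sub].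
    - by exists (X `|` P); split; [exact: FP|left|right|exact: sub].
    - by exists (Y `|` P); split; [exact: FP|right|left|exact: sub].
    - by exists P; split => // x; right.
  split.
  - by move=> x /posP; right.
  - by move=> a b /in2 H /H[Z [[_ Zadd _ _] Za Zb]]; apply; exact: Zadd.
  - by move=> a b /in2 H /H[Z [[_ _ Zmul _] Za Zb]]; apply; exact: Zmul.
  - by move=> H; have [Z [[_ _ _ Z1] Z1']] := in2 _ _ H H.
exists (Q `|` P); split => //.
move=> Q' prQ' QQ'; have PQ' : P `<=` Q' by move=> x Px; apply: QQ'; right.
apply: contrapT => Q'Q; apply: (maxQ Q').
  split; first by move=> x Qx; apply: QQ'; left.
  by move=> H; apply: Q'Q => x /H; left.
by suff : preordering (Q' `|` P) by []; rewrite setUidl.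
Qed.

(** P + xP is closed under sums and products, so by maximality either x is in P or -1 is in P + xP.
    If the latter held for both a and -a, multiplying a q = -(1 + p) by a q' = 1 + p' would exhibit
    -1 as an element of P. *)
Lemma preordering_total P a : preordering P ->
  (forall Q, preordering Q -> P `<=` Q -> Q `<=` P) -> P a \/ P (- a).
Proof.
move=> [posP addP mulP P1] maxP.
have P0' : P 0 by apply: posP; exact: rpos0.
have P1' : P 1 by apply: posP; exact: rpos1.
have ext x : P x \/ exists p q, [/\ P p, P q & p + x * q = -1].
  pose Q := [set y | exists p q, [/\ P p, P q & y = p + x * q]].
  have PQ : P `<=` Q.
    by move=> y Py; exists y, 0; split=> //; rewrite mulr0 addr0.
  have [[p [q [Pp Pq E]]]|Q1] := pselect (Q (-1)); first by right; exists p, q.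
  left; apply: (maxP Q) => //; last first.
    by exists 0, 1; split=> //; rewrite mulr1 add0r.
  split => //.
  - by move=> y /posP/PQ.
  - move=> _ _ [p [q [Pp Pq ->]]] [p' [q' [Pp' Pq' ->]]].
    by exists (p + p'), (q + q'); split; [exact: addP|exact: addP|ring].
  - move=> _ _ [p [q [Pp Pq ->]]] [p' [q' [Pp' Pq' ->]]].
    exists (p * p' + x ^+ 2 * (q * q')), (p * q' + p' * q); split; last by ring.
    + apply: (addP); first exact: mulP.
      by apply: (mulP); [apply: posP; exact: rpos_sqr|exact: mulP].
    + by apply: (addP); exact: mulP.
have [|[p [q [Pp Pq E]]]] := ext a; first by left.
have [|[p' [q' [Pp' Pq' E']]]] := ext (- a); first by right.
exfalso; apply: P1.
have aq : a * q = - (1 + p) by rewrite opprD -E; ring.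
have aq' : a * q' = 1 + p' by rewrite -[1]opprK -E'; ring.
have -> : -1 = p + p' + p * p' + a ^+ 2 * (q * q').
  have -> : a ^+ 2 * (q * q') = a * q * (a * q') by ring.
  by rewrite aq aq'; ring.
apply: (addP _ _ (addP _ _ (addP _ _ _ _) (mulP _ _ _ _))) => //.
by apply: (mulP); [apply: posP; exact: rpos_sqr|exact: mulP].
Qed.

(** The closure of P is again a preordering, so it equals P by maximality. Products are treated as
    in [rposM]; if -1 were in the closure, P would contain -1 + 1/2 and hence its double, -1. *)
Lemma preordering_closed P a : preordering P ->
  (forall Q, preordering Q -> P `<=` Q -> Q `<=` P) ->
  (forall e, 0 < e -> P (a + c e)) -> P a.
Proof.
move=> [posP addP mulP P1] maxP.
have cstP r : 0 <= r -> P (c r) by move=> r0; apply: posP; exact: rpos_cst.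
move: a; apply: (maxP [set a | forall e, 0 < e -> P (a + c e)]); last first.
  by move=> a Pa e e0; apply: (addP) => //; apply: cstP; exact: ltW.
split.
- by move=> a /posP Pa e e0; apply: (addP) => //; apply: cstP; exact: ltW.
- move=> a b Pa Pb e e0; have e20 : 0 < e / 2 by rewrite divr_gt0.
  have -> : a + b + c e = (a + c (e / 2)) + (b + c (e / 2)).
    by rewrite addrACA -rmorphD; congr (_ + c _); lra.
  by apply: (addP); [exact: Pa|exact: Pb].
- move=> a b Pa Pb e e0.
  pose K := N (a + b) + 1.
  have K0 : 0 < K by rewrite ltr_wpDl ?rnrm_ge0.
  pose d := Num.min 1 (e / (K + 1)).
  have d0 : 0 < d by rewrite lt_min ltr01 divr_gt0// addr_gt0.
  have d1 : d <= 1 by rewrite ge_min lexx.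
  have dK : d * (K + 1) <= e.
    by rewrite -ler_pdivlMr; [rewrite ge_min lexx orbT|lra].
  have -> : a * b + c e = (a + c d) * (b + c d) + c d * (c K - (a + b))
      + c (e - d * (K + d)).
    by rewrite !(rmorphD, rmorphB, rmorphM, rmorphN); ring.
  apply: (addP); first apply: (addP).
  + by apply: (mulP); [exact: Pa|exact: Pb].
  + apply: (mulP); first exact/cstP/ltW.
    by apply: posP; apply: rpos_upper; rewrite /K; lra.
  + by apply: cstP; nra.
- move=> /(_ 2^-1); rewrite invr_gt0 ltr0n => /(_ isT) H; apply: P1.
  have -> : -1 = (-1 + c 2^-1) + (-1 + c 2^-1) :> B.
    by rewrite addrACA half_half subrK.
  exact: addP.
Qed.

Lemma preordering_character P : preordering P ->
  (forall Q, preordering Q -> P `<=` Q -> Q `<=` P) ->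
  exists chi, rcharacter chi /\ forall a, P a -> 0 <= chi a.
Proof.
move=> prP maxP; have tot a := preordering_total a prP maxP.
have clP a := @preordering_closed P a prP maxP.
have [posP addP mulP P1] := prP.
have cstP r : 0 <= r -> P (c r) by move=> r0; apply: posP; exact: rpos_cst.
have cst_ge0 r : P (c r) -> 0 <= r.
  move=> Pr; rewrite leNgt; apply/negP => r0; apply: P1.
  rewrite (_ : -1 = c (- r^-1) * c r); last first.
    by rewrite -rmorphM mulNr mulVf ?lt_eqF// rmorphN1.
  by apply: (mulP) => //; apply: cstP; rewrite oppr_ge0 invr_le0 ltW.
(* This says that a and t agree modulo the intersection of P and -P; the character will send a to
   the only such t. *)
pose rel a t := P (a - c t) /\ P (c t - a).
have rel_ge0 a t : P a -> rel a t -> 0 <= t.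
  move=> Pa [_ H]; apply: cst_ge0.
  by have -> : c t = c t - a + a by [ring|]; exact: addP.
have rel_cst r : rel (c r) r.
  by rewrite /rel subrr; split; rewrite -(rmorph0 c); exact: cstP.
have relD a b s t : rel a s -> rel b t -> rel (a + b) (s + t).
  move=> [h1 h2] [k1 k2]; rewrite /rel rmorphD; split.
    by rewrite opprD addrACA; exact: addP.
  by rewrite opprD addrACA; exact: addP.
have relN a s : rel a s -> rel (- a) (- s).
  move=> [h1 h2]; rewrite /rel rmorphN !opprK.
  by rewrite [- a + _]addrC [- c s + _]addrC; split.
have rel_le a s t : rel a s -> rel a t -> s <= t.
  move=> /relN rs rt; rewrite -subr_ge0; apply: (rel_ge0 (a - a)).
    by rewrite subrr; apply: posP; exact: rpos0.
  exact: relD.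
have rel_inj a s t : rel a s -> rel a t -> s = t.
  move=> rs rt; apply/eqP.
  by rewrite eq_le (rel_le _ _ _ rs rt) (rel_le _ _ _ rt rs).
(* The intersection of P and -P is an ideal, because b or -b lies in P by totality. *)
have relM0 a b : rel a 0 -> rel (a * b) 0.
  rewrite /rel rmorph0 !subr0 !sub0r => -[h1 h2].
  have [Pb|Pb] := tot b; split.
  - exact: mulP.
  - by rewrite -mulNr; exact: mulP.
  - by rewrite -mulrNN; exact: mulP.
  - by rewrite -mulrN; exact: mulP.
have rel_sub a s : rel a s -> rel (a - c s) 0.
  by move=> ra; rewrite -(subrr s); apply: (relD) => //; apply: relN.
have relM a b s t : rel a s -> rel b t -> rel (a * b) (s * t).
  move=> ra rb.
  have -> : a * b = (a - c s) * b + ((b - c t) * c s + c (s * t)).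
    by rewrite rmorphM; ring.
  rewrite -[X in rel _ X]add0r -[X in rel _ (_ + X)]add0r.
  apply: (relD); first exact/relM0/rel_sub.
  by apply: (relD); [exact/relM0/rel_sub|exact: rel_cst].
(* The value is the supremum of the lower cut of a. Closedness of P reduces both memberships to
   shifts by e > 0, obtained from a point of the cut near the supremum and from totality just above
   it. *)
have rel_ex a : exists t, rel a t.
  pose S := [set t | P (a - c t)].
  have upS t : S t -> t <= N a.
    move=> St; rewrite -subr_ge0; apply: cst_ge0.
    have -> : c (N a - t) = c (N a) - a + (a - c t) by rewrite rmorphB; ring.
    by apply: (addP) => //; apply: posP; exact: rpos_upper.
  have hS : has_sup S.
    split; last by exists (N a).
    exists (- N a); rewrite /S /= rmorphN opprK.
    by apply: posP; exact: rpos_addcst.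
  exists (sup S); split; apply: clP => e e0.
    have [t St et] := sup_adherent e0 hS.
    have -> : a - c (sup S) + c e = a - c t + c (t - (sup S - e)).
      by rewrite !(rmorphB, rmorphD, rmorphN); ring.
    by apply: (addP) => //; apply: cstP; rewrite subr_ge0 ltW.
  have [H|] := tot (a - c (sup S + e)).
    by have := sup_upper_bound hS H; lra.
  by rewrite opprB rmorphD addrAC.
have [chi chiP] := choice rel_ex.
exists chi; split; last by move=> a /rel_ge0; apply.
split.
- by move=> r; apply: rel_inj (chiP _) (rel_cst r).
- by move=> a b; apply: rel_inj (chiP _) (relD _ _ _ _ (chiP _) (chiP _)).
- by move=> a b; apply: rel_inj (chiP _) (relM _ _ _ _ (chiP _) (chiP _)).
Qed.

(** If a is not positive, [rpos_of_cert] keeps -1 out of the preordering generated by -a, and a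
    maximal extension of it gives a character with a nonpositive value at a. *)
Theorem rpos_of_characters a :
  (forall chi, rcharacter chi -> 0 < chi a) -> rpos a.
Proof.
move=> chi_gt0; apply: contrapT => na.
pose P := [set y | exists p q, [/\ rpos p, rpos q & y = p - a * q]].
have posP : @rpos R B `<=` P.
  by move=> p p0; exists p, 0; split => //; [exact: rpos0|rewrite mulr0 subr0].
have prP : preordering P.
  split => //.
  - move=> _ _ [p [q [p0 q0 ->]]] [p' [q' [p0' q0' ->]]].
    by exists (p + p'), (q + q'); split; [exact: rposD|exact: rposD|ring].
  - move=> _ _ [p [q [p0 q0 ->]]] [p' [q' [p0' q0' ->]]].
    exists (p * p' + a ^+ 2 * (q * q')), (p * q' + p' * q); split; last by ring.
    + by apply: rposD; apply: rposM => //; [exact: rpos_sqr|exact: rposM].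
    + by apply: rposD; exact: rposM.
  - move=> [p [q [p0 q0 E]]]; apply: na; apply: rpos_of_cert p0 q0 _.
    by rewrite -[1]opprK E; ring.
have [Q [prQ PQ maxQ]] := maximal_preordering prP.
have [chi [chiP chi0]] := preordering_character prQ maxQ.
have /chi0 : Q (- a).
  apply: PQ; exists 0, 1; split; [exact: rpos0|exact: rpos1|].
  by rewrite mulr1 sub0r.
have [chic chiD _] := chiP.
have : chi a + chi (- a) = 0 by rewrite -chiD subrr -(rmorph0 c) chic.
by have := chi_gt0 _ chiP; lra.
Qed.

Lemma rcharacter_ge0 chi a : rcharacter chi -> rpos a -> 0 <= chi a.
Proof.
move=> [chic chiD chiM] a0; apply/ler_addgt0Pr => e e0.
have [y yP _] := rpos_sqrt e0 a0.
by rewrite -[e]chic -chiD -yP expr2 chiM -expr2 sqr_ge0.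
Qed.

Lemma rcharacter_norm chi a : rcharacter chi -> `|chi a| <= N a.
Proof.
move=> chiP; have [chic chiD _] := chiP.
have chiN b : chi (- b) = - chi b.
  by apply/eqP; rewrite -addr_eq0 -chiD addNr -(rmorph0 c) chic.
have := rcharacter_ge0 chiP (rpos_upper (lexx (N a))).
have := rcharacter_ge0 chiP (rpos_addcst (lexx (N a))).
by rewrite !chiD chiN chic ler_norml; lra.
Qed.

(** The elements t + e - a and t + e + a are strictly positive at all characters, as
    [rpos_of_characters] demands; then e tends to 0. *)
Theorem rnrm_le_characters a t : 0 <= t ->
  (forall chi, rcharacter chi -> `|chi a| <= t) -> N a <= t.
Proof.
move=> t0 chit; apply/ler_addgt0Pr => e e0.
have te : 0 <= t + e by rewrite addr_ge0// ltW.
apply: rpos_norm => //; apply: rpos_of_characters => chi chiP.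
  have [chic chiD _] := chiP.
  have := chit _ chiP; have := chiD (c (t + e)  - a) a.
  by rewrite subrK chic ler_norml; lra.
have [chic chiD _] := chiP.
by have := chit _ chiP; rewrite chiD chic ler_norml; lra.
Qed.

End RealCharacters.

(** * The Stone-Weierstrass theorem *)

(* By compactness, applied to the filter generated by the closed sets
   [g <= f], whose common points the pointwise hypothesis rules out. *)
Lemma compact_directed_lt (R : realType) (X : topologicalType)
    (Phi : set (X -> R)) (f : X -> R) :
    compact [set: X] -> continuous f -> Phi !=set0 ->
    (forall g, Phi g -> continuous g) ->
    (forall g h, Phi g -> Phi h -> Phi (g \max h)) ->
    (forall x, exists2 g, Phi g & f x < g x) ->
  exists2 g, Phi g & forall x, f x < g x.
Proof.
move=> cX cf Phi0 cPhi maxPhi fPhi; apply: contrapT => nPhi.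
pose F := filter_from Phi (fun g => [set x | g x <= f x]).
have FF : ProperFilter F.
  apply: filter_from_proper.
    apply: filter_from_filter => // g h Pg Ph.
    exists (g \max h); first exact: maxPhi.
    by move=> x /=; rewrite ge_max => /andP.
  move=> g Pg; apply: contrapT => ng; apply: nPhi; exists g => // x.
  by rewrite ltNge; apply/negP => gx; apply: ng; exists x.
have [p [_ clp]] := cX F FF filterT.
have [g Pg fg] := fPhi p.
have fgp : nbhs p [set x | 0 < g x - f x].
  have cgf : {for p, continuous (fun x => g x - f x)}.
    by apply: cvgB; [exact: cPhi|exact: cf].
  by apply: (cvgr_gt _ cgf); rewrite subr_gt0.
have [|x [/=]] := clp [set x | g x <= f x] _ _ fgp; first by exists g.
by rewrite subr_gt0 => h1 /(le_lt_trans h1); rewrite ltxx.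
Qed.

Section StoneWeierstrass.
Context (R : realType) (B : realCstarAlg R) (X : topologicalType).
Context (ev : X -> B -> R).
Context (cX : compact [set: X]).
Context (evP : forall x, rcharacter (ev x)).
Context (cev : forall b, continuous (ev ^~ b)).
Context (ev_sep : forall x y, x <> y -> exists b, ev x b <> ev y b).
Context (ev_norm :
  forall b (t : R), 0 <= t -> (forall x, `|ev x b| <= t) -> rnrm b <= t).
Local Notation c := (@rcst R B).

Let evc x r : ev x (c r) = r. Proof. by have [] := evP x. Qed.
Let evD x a b : ev x (a + b) = ev x a + ev x b. Proof. by have [] := evP x. Qed.
Let evM x a b : ev x (a * b) = ev x a * ev x b. Proof. by have [] := evP x. Qed.
Let evN x b : ev x (- b) = - ev x b.
Proof. by rewrite -mulN1r -(rmorphN1 c) evM evc mulN1r. Qed.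

Definition approximable (f : X -> R) :=
  forall e, 0 < e -> exists b, forall x, `|ev x b - f x| <= e.

Lemma approximable_ev b : approximable (ev ^~ b).
Proof. by move=> e e0; exists b => x; rewrite subrr normr0 ltW. Qed.

Lemma approximableN f : approximable f -> approximable (\- f).
Proof.
move=> Df e /Df[b bf]; exists (- b) => x.
by rewrite evN -opprD normrN.
Qed.

Lemma approximable_max f g :
  approximable f -> approximable g -> approximable (f \max g).
Proof.
move=> Df Dg e e0; have e20 : 0 < e / 2 by rewrite divr_gt0.
have [a af] := Df _ e20; have [b bg] := Dg _ e20.
(* In max(u, v) = (u + v + |u - v|)/2 the absolute value is replaced by the positive root of (u -
   v)^2 + (e/2)^2, which exceeds it by at most e/2. *)
have [y yP y0] := rpos_sqrt (exprn_gt0 2 e20) (rpos_sqr (a - b)).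
exists (c 2^-1 * (a + b + y)) => x; rewrite evM evc !evD.
have {}y0 := rcharacter_ge0 (evP x) y0.
have : ev x y ^+ 2 = (ev x a - ev x b) ^+ 2 + (e / 2) ^+ 2.
  by rewrite expr2 -evM -expr2 yP evD evc expr2 evM -expr2 evD evN.
have := af x; have := bg x; rewrite !ler_norml.
set u := ev x a; set v := ev x b; set w := ev x y in y0 *.
move=> /andP[g1 g2] /andP[f1 f2] wP.
have w1 : u - v <= w by nra.
have w2 : v - u <= w by nra.
have w3 : w <= e / 2 + (u - v) \/ w <= e / 2 + (v - u).
  by have [uv|uv] := leP v u; [left|right]; nra.
rewrite /Order.max_fun; have [fg|fg] := leP (f x) (g x); apply/andP; split; lra.
Qed.

Lemma approximable_continuous f : continuous f -> approximable f.
Proof.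
(* One half is spent on a lattice function near [f], the other on an element of [B] near that
   function. *)
move=> cf e' e'0; pose e := e' / 2; have e0 : 0 < e by rewrite divr_gt0.
(* The point [x0] will show that the family [Psi] is nonempty. *)
have [X0|/set0P[x0 _]] := eqVneq [set: X] set0.
  by exists 0 => x; have : [set: X] x by []; rewrite X0.
(* Two-point interpolation by an affine function of a separating element. *)
have cD x y : exists b, ev x b = f x /\ ev y b = f y.
  have [<-|xy] := pselect (x = y); first by exists (c (f x)); rewrite evc.
  have [b /eqP bxy] := ev_sep xy.
  exists (c ((f x - f y) / (ev x b - ev y b)) * (b - c (ev y b)) + c (f y)).
  rewrite !(evD, evM, evN, evc); split; last by rewrite subrr mulr0 add0r.
  by rewrite divfK ?subrK// subr_eq0.
pose D := [set g | approximable g /\ continuous g].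
have cfe r : continuous (fun x => f x + r).
  by move=> x; apply: cvgD; [exact: cf|exact: cvg_cst].
have maxD g h : D g -> D h -> D (g \max h).
  move=> [Dg cg] [Dh ch]; split; first exact: approximable_max.
  by move=> x; apply: continuous_max; [exact: cg|exact: ch].
have step x : exists g, [/\ D g, g x < f x + e & forall y, f y + - e < g y].
  pose Phi := [set g | D g /\ g x < f x + e].
  have Phiy y : exists2 g, Phi g & f y + - e < g y.
    have [b [bx by_]] := cD x y; exists (ev ^~ b); last by rewrite by_; lra.
    by split; [split; [exact: approximable_ev|exact: cev]|rewrite bx; lra].
  have [| | |g [Dg gx] gP] := compact_directed_lt cX (cfe (- e)) _ _ _ Phiy.
  - by have [g Pg _] := Phiy x; exists g.
  - by move=> g [[]].
  - move=> g h [Dg gx] [Dh hx]; split; first exact: maxD.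
    by rewrite /Order.max_fun gt_max gx hx.
  by exists g; split.
(* Passing to negatives turns the minimum that is now required into a maximum, so that
   [compact_directed_lt] serves a second time. *)
pose Psi := [set h | D h /\ forall y, h y < - f y + e].
have cNf : continuous (fun x => - f x + - e).
  by move=> x; apply: cvgD; [apply: cvgN; exact: cf|exact: cvg_cst].
have Psiy y : exists2 h, Psi h & - f y + - e < h y.
  have [g [[Dg cg] gx gP]] := step y; exists (\- g); last by rewrite /=; lra.
  split; last by move=> z /=; have := gP z; lra.
  by split; [exact: approximableN|move=> z; apply: cvgN; exact: cg].
have [| | |h [[Dh ch] hf] hP] := compact_directed_lt cX cNf _ _ _ Psiy.
- by have [h Ph _] := Psiy x0; exists h.
- by move=> h [[]].
- move=> g h [Dg gx] [Dh hx]; split; first exact: maxD.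
  by move=> y; rewrite /Order.max_fun gt_max gx hx.
have [b bh] := Dh _ e0; exists (- b) => x; rewrite evN.
have := bh x; have := hf x; have := hP x; rewrite !ler_norml /e.
by move=> ? ? /andP[? ?]; apply/andP; split; lra.
Qed.

(** By [ev_norm], approximants within 2^-n of f form a Cauchy sequence in [B]; its limit evaluates
    to f because characters are contractive. *)
Theorem ev_surjective f : continuous f -> exists b, forall x, ev x b = f x.
Proof.
move=> /approximable_continuous Df.
have half_gt0 : 0 < 2^-1 :> R by rewrite invr_gt0.
have half1 : 2^-1 < 1 :> R by rewrite invf_lt1 ?ltr1n.
have [b bP] := choice (fun n => Df _ (exprn_gt0 n half_gt0)).
have small e : 0 < e -> exists n0, forall n, (n0 <= n)%N ->
    forall x, `|ev x (b n) - f x| < e.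
  move=> e0; have [n0 n0P] := geometric_small 1 (ltW half_gt0) half1 e0.
  exists n0 => n n0n x; apply: le_lt_trans (bP n x) _.
  by rewrite -[_ ^+ n]mul1r n0P.
have [|l lP] := @rnrm_complete R B b.
  move=> e e0; have e20 : 0 < e / 3 by rewrite divr_gt0.
  have [n0 n0P] := small _ e20; exists n0 => m n n0m n0n.
  have : rnrm (b m - b n) <= e / 3 + e / 3.
    apply: ev_norm => [|x]; first by lra.
    have := n0P m n0m x; have := n0P n n0n x.
    rewrite evD evN !ltr_norml ler_norml => /andP[? ?] /andP[? ?].
    by apply/andP; split; lra.
  by lra.
exists l => x; apply/eqP; rewrite -subr_eq0 -normr_le0.
apply/ler_addgt0Pr => e e0; rewrite add0r.
have e20 : 0 < e / 2 by rewrite divr_gt0.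
have [n1 n1P] := lP _ e20; have [n2 n2P] := small _ e20.
have := n1P _ (leq_maxl n1 n2); have := n2P _ (leq_maxr n1 n2) x.
have := rcharacter_norm (b (maxn n1 n2) - l) (evP x).
rewrite evD evN; move: (ev x l) (ev x _) (rnrm _) (f x) => u v w z.
rewrite ltr_norml !ler_norml => /andP[? ?] /andP[? ?] ?.
by apply/andP; split; lra.
Qed.

End StoneWeierstrass.

(** * Self-adjoint parts of commutative algebras of endomorphisms *)

Section CstarCategory.
Context (R : realType) (T : cstarCat R).
Implicit Types r s t : T.

Lemma acompDl r s t (a a' : arr s t) (b : arr r s) :
  acomp (a + a') b = acomp a b + acomp a' b.
Proof. by have := acomp_linearl 1 a a' b; rewrite !scale1r. Qed.

Lemma acompDr r s t (a : arr s t) (b b' : arr r s) :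
  acomp a (b + b') = acomp a b + acomp a b'.
Proof. by have := acomp_linearr 1 a b b'; rewrite !scale1r. Qed.

Lemma acomp0l r s t (b : arr r s) : acomp (0 : arr s t) b = 0.
Proof. by apply: (addrI (acomp 0 b)); rewrite -acompDl !addr0. Qed.

Lemma acomp0r r s t (a : arr s t) : acomp a (0 : arr r s) = 0.
Proof. by apply: (addrI (acomp a 0)); rewrite -acompDr !addr0. Qed.

Lemma acompZl r s t (z : R[i]) (a : arr s t) (b : arr r s) :
  acomp (z *: a) b = z *: acomp a b.
Proof. by have := acomp_linearl z a 0 b; rewrite !addr0 acomp0l addr0. Qed.

Lemma acompZr r s t (z : R[i]) (a : arr s t) (b : arr r s) :
  acomp a (z *: b) = z *: acomp a b.
Proof. by have := acomp_linearr z a b 0; rewrite !addr0 acomp0r addr0. Qed.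

Lemma astarD r s (a b : arr r s) : astar (a + b) = astar a + astar b.
Proof. by have := astar_antilinear 1 a b; rewrite rmorph1 !scale1r. Qed.

Lemma astar0 r s : astar (0 : arr r s) = 0.
Proof. by apply: (addrI (astar 0)); rewrite -astarD !addr0. Qed.

Lemma astarZ r s (z : R[i]) (a : arr r s) : astar (z *: a) = z^* *: astar a.
Proof. by have := astar_antilinear z a 0; rewrite astar0 !addr0. Qed.

Lemma astarN r s (a : arr r s) : astar (- a) = - astar a.
Proof. by rewrite -scaleN1r astarZ rmorphN1 scaleN1r. Qed.

Definition anorm r s (a : arr r s) : R := complex.Re `|a|.

Lemma anormE r s (a : arr r s) : `|a| = (anorm a)%:C.
Proof. by rewrite /anorm RRe_real// ger0_real. Qed.

Lemma anormD r s (a b : arr r s) : anorm (a + b) <= anorm a + anorm b.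
Proof. by rewrite -lecR rmorphD /= -!anormE ler_normD. Qed.

Lemma anormZ r s (t : R) (a : arr r s) : anorm (t%:C *: a) = `|t| * anorm a.
Proof.
have : `|t%:C *: a| = `|t%:C| * `|a| by rewrite normrZ.
rewrite !anormE normc_def /= expr0n addr0 sqrtr_sqr -rmorphM.
by move=> -[].
Qed.

Lemma anormN r s (a : arr r s) : anorm (- a) = anorm a.
Proof. by rewrite /anorm normrN. Qed.

Lemma anormM r s t (a : arr s t) (b : arr r s) :
  anorm (acomp a b) <= anorm a * anorm b.
Proof. by rewrite -lecR rmorphM /= -!anormE acomp_norm. Qed.

Lemma anorm_ge0 r s (a : arr r s) : 0 <= anorm a.
Proof. by rewrite -lecR -anormE normr_ge0. Qed.

Lemma anorm0_eq0 r s (a : arr r s) : anorm a = 0 -> a = 0.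
Proof. by move=> a0; apply/eqP; rewrite -normr_eq0 anormE a0 eqxx. Qed.

Lemma anorm_star r s (a : arr r s) : anorm (astar a) = anorm a.
Proof. by rewrite /anorm astar_isometric. Qed.

Lemma anorm_cstar r s (a : arr r s) :
  anorm (acomp (astar a) a) = anorm a ^+ 2.
Proof.
have := cstar_identity a.
by rewrite !anormE -rmorphXn => -[].
Qed.

(** For u = h + ik, commutation gives h^2 + k^2 as the product of [astar u] and u, while h is the
    mean of u and [astar u]. *)
Lemma anorm_sqrD r (h k : arr r r) :
    astar h = h -> astar k = k -> acomp h k = acomp k h ->
  anorm h ^+ 2 <= anorm (acomp h h + acomp k k).
Proof.
move=> hh kk hk; pose u := h + 'i *: k.
have us : astar u = h - 'i *: k.
  by rewrite astarD astarZ hh kk conjCi scaleNr.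
have uu : acomp (astar u) u = acomp h h + acomp k k.
  rewrite us /u !(acompDl, acompDr) -scaleNr !(acompZl, acompZr) hk scalerA.
  by rewrite mulNr -expr2 sqrCi opprK scale1r scaleNr addrACA addrA subrK.
rewrite -uu anorm_cstar ler_pXn2r ?nnegrE ?anorm_ge0//.
have -> : h = (2^-1)%:C *: (u + astar u).
  rewrite us /u addrACA subrr addr0 scalerDr -scalerDl -rmorphD.
  by rewrite (_ : 2^-1 + 2^-1 = 1) ?scale1r//; lra.
rewrite anormZ ger0_norm ?invr_ge0//.
by have := anormD u (astar u); rewrite anorm_star; lra.
Qed.

Lemma anorm_complete r s (u : nat -> arr r s) :
  (forall e, 0 < e -> exists n0, forall m n, (n0 <= m)%N -> (n0 <= n)%N ->
     anorm (u m - u n) < e) ->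
  exists l : arr r s, u n @[n --> \oo] --> l.
Proof.
move=> cu; suff /cvg_ex : cvg (u n @[n --> \oo]) by [].
apply: cauchy_cvg; apply: cauchy_exP => e e0.
have eE : e = (complex.Re e)%:C by rewrite RRe_real// gtr0_real.
have [|n0 n0P] := cu (complex.Re e); first by rewrite -ltcR -eE.
exists (u n0); exists n0 => // n /= n0n.
by rewrite -ball_normE /= anormE eE ltcR n0P.
Qed.

Lemma cvg_anorm r s (u : nat -> arr r s) (l : arr r s) :
  u n @[n --> \oo] --> l ->
  forall e, 0 < e -> exists n0, forall n, (n0 <= n)%N -> anorm (u n - l) < e.
Proof.
move=> ul e e0; have ec0 : 0 < e%:C by rewrite ltcR.
have /cvgrPdistC_lt/(_ _ ec0)[n0 _ n0P] := ul.
by exists n0 => n /n0P /=; rewrite anormE ltcR.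
Qed.

End CstarCategory.

(** It has two instances: all of (iota, iota), which serves to show that star-morphisms are
    contractive, and the central elements, whose closedness follows from that. *)
Record comm_subalgebra (R : realType) (T : cstarCat R) (r : T)
    (A : set (arr r r)) : Prop := {
  subalg_id : A (idarr r);
  subalg_linear : forall (z : R[i]) a b, A a -> A b -> A (z *: a + b);
  subalg_comp : forall a b, A a -> A b -> A (acomp a b);
  subalg_comm : forall a b, A a -> A b -> acomp a b = acomp b a;
  subalg_closed : closed A
}.

Section SelfAdjointPart.
Context (R : realType) (T : cstarCat R) (r : T) (A : set (arr r r)).
Context (hA : comm_subalgebra A).

(** The proof is a phantom argument: the algebraic instances on this predicate depend on it, and
    unification has to recover it. *)
Definition sa_pred of comm_subalgebra A : {pred arr r r} :=
  mem [set a | A a /\ astar a = a].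

Lemma sa_predP a : reflect (A a /\ astar a = a) (a \in sa_pred hA).
Proof. by apply: (iffP idP) => [/set_mem//|H]; apply/mem_set. Qed.

Let A0 : A 0.
Proof.
have := subalg_linear hA (-1) (subalg_id hA) (subalg_id hA).
by rewrite scaleN1r addNr.
Qed.

Lemma sa_zmod_closed : zmod_closed (sa_pred hA).
Proof.
split=> [|a b /sa_predP[Aa sa] /sa_predP[Ab sb]]; apply/sa_predP.
  by rewrite astar0.
rewrite astarD astarN sa sb; split => //.
by rewrite addrC -scaleN1r; exact: (subalg_linear hA).
Qed.

HB.instance Definition _ :=
  GRing.isZmodClosed.Build (arr r r) (sa_pred hA) sa_zmod_closed.

Record sa_part := SaPart {
  sa_val :> arr r r;
  sa_valP : sa_val \in sa_pred hA
}.

HB.instance Definition _ := [isSub for sa_val].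
HB.instance Definition _ := [Choice of sa_part by <:].
HB.instance Definition _ := [SubChoice_isSubZmodule of sa_part by <:].

Lemma sa_in (a : sa_part) : A a. Proof. by have /sa_predP[] := sa_valP a. Qed.

Lemma sa_star (a : sa_part) : astar a = a.
Proof. by have /sa_predP[] := sa_valP a. Qed.

Lemma sa_id_subproof : idarr r \in sa_pred hA.
Proof. by apply/sa_predP; rewrite astar_id; split => //; exact: subalg_id. Qed.

Lemma sa_mul_subproof (a b : sa_part) : acomp a b \in sa_pred hA.
Proof.
apply/sa_predP; rewrite astar_comp !sa_star; split.
  by apply: subalg_comp => //; exact: sa_in.
by apply: (subalg_comm hA); exact: sa_in.
Qed.

Definition sa_one := SaPart sa_id_subproof.
Definition sa_mul a b := SaPart (sa_mul_subproof a b).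

Lemma sa_mulA : associative sa_mul.
Proof. by move=> a b d; apply/val_inj; rewrite /= acompA. Qed.

Lemma sa_mulC : commutative sa_mul.
Proof.
by move=> a b; apply/val_inj; apply: (subalg_comm hA); exact: sa_in.
Qed.

Lemma sa_mul1 : left_id sa_one sa_mul.
Proof. by move=> a; apply/val_inj; rewrite /= acomp1l. Qed.

Lemma sa_mulDl : left_distributive sa_mul +%R.
Proof. by move=> a b d; apply/val_inj; rewrite /= acompDl. Qed.

HB.instance Definition _ := GRing.Zmodule_isComPzRing.Build sa_part
  sa_mulA sa_mulC sa_mul1 sa_mulDl.

Lemma sa_cst_subproof (t : R) : t%:C *: idarr r \in sa_pred hA.
Proof.
apply/sa_predP; rewrite astarZ astar_id; split.
  by rewrite -[_ *: _]addr0; apply: (subalg_linear hA) => //; exact: subalg_id.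
by congr (_ *: _); apply: CrealP; apply/complex_realP; exists t.
Qed.

Definition sa_cst (t : R) := SaPart (sa_cst_subproof t).

Lemma sa_cst_zmod : zmod_morphism sa_cst.
Proof. by move=> s t; apply/val_inj; rewrite /= rmorphB scalerBl. Qed.

Lemma sa_cst_monoid : monoid_morphism sa_cst.
Proof.
split; first by apply/val_inj; rewrite /= scale1r.
move=> s t; apply/val_inj.
by rewrite /= rmorphM acompZl acompZr acomp1l scalerA.
Qed.

HB.instance Definition _ :=
  GRing.isZmodMorphism.Build R sa_part sa_cst sa_cst_zmod.
HB.instance Definition _ :=
  GRing.isMonoidMorphism.Build R sa_part sa_cst sa_cst_monoid.

Definition sa_norm (a : sa_part) : R := anorm a.

Lemma sa_complete (u : nat -> sa_part) :
  (forall e, 0 < e -> exists n0, forall m n, (n0 <= m)%N -> (n0 <= n)%N ->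
     sa_norm (u m - u n) < e) ->
  exists l, forall e, 0 < e -> exists n0, forall n, (n0 <= n)%N ->
    sa_norm (u n - l) < e.
Proof.
move=> /anorm_complete[l ul].
have Al : A l.
  apply: (@closed_cvg _ _ _ _ _ A (subalg_closed hA) _ l ul).
  by apply: nearW => n; exact: sa_in.
have ulP := cvg_anorm ul.
have sl : astar l = l.
  apply/eqP; rewrite -subr_eq0; apply/eqP/anorm0_eq0/eqP.
  rewrite eq_le anorm_ge0 andbT; apply/ler_addgt0Pr => e e0; rewrite add0r.
  have [|n nP] := ulP (e / 2); first by rewrite divr_gt0.
  have := anormD (astar (l - val (u n))) (val (u n) - l).
  have := nP n (leqnn n); have : anorm (l - val (u n)) = anorm (val (u n) - l).
    by rewrite -opprB anormN.
  by rewrite anorm_star astarD astarN sa_star addrA subrK; lra.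
have lP : l \in sa_pred hA by apply/sa_predP.
by exists (SaPart lP).
Qed.

Lemma sa_normZ (t : R) (a : sa_part) :
  sa_norm (sa_cst t * a) = `|t| * sa_norm a.
Proof. by rewrite /sa_norm /= acompZl acomp1l anormZ. Qed.

Lemma sa_norm_sqrD (a b : sa_part) :
  sa_norm a ^+ 2 <= sa_norm (a ^+ 2 + b ^+ 2).
Proof.
apply: anorm_sqrD; [exact: sa_star|exact: sa_star|].
by apply: (subalg_comm hA); exact: sa_in.
Qed.

(** Kept transparent, because later arguments convert between its carrier and [sa_part]. *)
Definition sa_cstar : realCstarAlg R.
Proof.
refine (@RealCstarAlg R sa_part sa_cst sa_norm _ sa_normZ _ _ sa_norm_sqrD
  sa_complete).
- by move=> a b; exact: anormD.
- by move=> a b; exact: anormM.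
- by move=> a a0; apply/val_inj/anorm0_eq0.
Defined.

End SelfAdjointPart.

(** * Central elements *)

Section Castarr.
Context (R : realType) (T : cstarCat R).
Implicit Types r s t : T.

Lemma castarr_acomp r r' s s' t t' (er : r = r') (es : s = s') (et : t = t')
    (a : arr s t) (b : arr r s) :
  castarr er et (acomp a b) = acomp (castarr es et a) (castarr er es b).
Proof. by case: r' / er; case: s' / es; case: t' / et. Qed.

Lemma castarr_star r r' s s' (er : r = r') (es : s = s') (a : arr r s) :
  astar (castarr er es a) = castarr es er (astar a).
Proof. by case: r' / er; case: s' / es. Qed.

Lemma castarr_trans r r' r'' s s' s'' (er : r = r') (er' : r' = r'')
    (es : s = s') (es' : s' = s'') (a : arr r s) :
  castarr er' es' (castarr er es a) = castarr (etrans er er') (etrans es es') a.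
Proof. by case: r'' / er'; case: s'' / es'. Qed.

Lemma castarr_irr r r' s s' (er er' : r = r') (es es' : s = s') (a : arr r s) :
  castarr er es a = castarr er' es' a.
Proof. by rewrite (Prop_irrelevance er er') (Prop_irrelevance es es'). Qed.

End Castarr.

Section TensorCategory.
Context (R : realType) (T : tensorCstarCat R).
Implicit Types r s t : T.
Local Notation I := (ounit T).

Lemma tens_castl r r' s (e : r = r') (a : arr r r) (b : arr s s) :
  tens (castarr e e a) b =
  castarr (congr1 (otens^~ s) e) (congr1 (otens^~ s) e) (tens a b).
Proof. by case: r' / e. Qed.

Lemma tens_castr r s s' (e : s = s') (a : arr r r) (b : arr s s) :
  tens a (castarr e e b) =
  castarr (congr1 (otens r) e) (congr1 (otens r) e) (tens a b).
Proof. by case: s' / e. Qed.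

(** Strict associativity together with 1_rs = 1_r (x) 1_s. It moves the action of f out of the left
    tensor factor. *)
Lemma tens_tens_idr (f : arr I I) r s :
  tens (tens_idr f r) (idarr s) = tens_idr f (otens r s).
Proof.
rewrite /tens_idr -tens_id -tensmA tens_castl castarr_trans.
exact: castarr_irr.
Qed.

Lemma tens_tens_idl (f : arr I I) r s :
  tens (idarr r) (tens_idl f s) = tens_idl f (otens r s).
Proof.
rewrite /tens_idl -tens_id tens_castr -tensmA castarr_trans.
exact: castarr_irr.
Qed.

(** Up to transport both sides are f (x) t, by the interchange law. *)
Lemma tens_idr_natural (f : arr I I) r s (t : arr r s) :
  acomp t (tens_idr f r) = acomp (tens_idr f s) t.
Proof.
rewrite /tens_idr -{1}(tensm1l t) -{2}(tensm1l t) -!castarr_acomp -!tens_comp.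
by rewrite !acomp1l !acomp1r.
Qed.

(* Eckmann-Hilton *)
Lemma acomp_unitC (a b : arr I I) : acomp a b = acomp b a.
Proof.
have e : otens1l I = otens1r I by exact: Prop_irrelevance.
rewrite -(tensm1r a) -(tensm1l b) -e -!castarr_acomp -!tens_comp.
by rewrite !acomp1l !acomp1r.
Qed.

Lemma comm_subalgebra_unit : comm_subalgebra [set: arr I I].
Proof. by split => // a b _ _; exact: acomp_unitC. Qed.

Lemma anorm_id (U : cstarCat R) (r : U) : anorm (idarr r) <= 1.
Proof.
have := anorm_cstar (idarr r); rewrite astar_id acomp1l.
by have := anorm_ge0 (idarr r); rewrite expr2; nra.
Qed.

Definition star_morphism r (phi : arr I I -> arr r r) : Prop :=
  [/\ linear phi, forall a b, phi (acomp a b) = acomp (phi a) (phi b),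
      forall a, phi (astar a) = astar (phi a) & phi (idarr I) = idarr r].

Lemma tens_idr_star_morphism r : star_morphism (fun f => tens_idr f r).
Proof.
split=> [||a|].
- exact: tens_idr_linear.
- move=> a b.
  by rewrite /tens_idr -[idarr r]acomp1r tens_comp castarr_comp acomp1r.
- by rewrite /tens_idr castarr_star tens_star astar_id.
- by rewrite /tens_idr tens_id castarr_idarr.
Qed.

Lemma tens_idl_star_morphism r : star_morphism (fun f => tens_idl f r).
Proof.
split=> [||a|].
- exact: tens_idl_linear.
- move=> a b.
  by rewrite /tens_idl -[idarr r]acomp1r tens_comp castarr_comp acomp1r.
- by rewrite /tens_idl castarr_star tens_star astar_id.
- by rewrite /tens_idl tens_id castarr_idarr.
Qed.

Lemma linear_D (U V : lmodType R[i]) (h : U -> V) : linear h ->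
  {morph h : a b / a + b}.
Proof. by move=> hl a b; rewrite -[a]scale1r hl !scale1r. Qed.

Lemma linear_0 (U V : lmodType R[i]) (h : U -> V) : linear h -> h 0 = 0.
Proof.
by move=> hl; have := hl (-1) 0 0; rewrite scaler0 addr0 scaleN1r addNr.
Qed.

Lemma linear_Z (U V : lmodType R[i]) (h : U -> V) : linear h ->
  forall z a, h (z *: a) = z *: h a.
Proof. by move=> hl z a; rewrite -[z *: a]addr0 hl linear_0// addr0. Qed.

(* With h^2 + k^2 = t^2, phi(h) is dominated by |phi(h) + i phi(k)| = t. *)
Lemma star_morphism_contractive r (phi : arr I I -> arr r r) :
  star_morphism phi -> forall a, anorm (phi a) <= anorm a.
Proof.
move=> [philin phiM phistar phi1].
have sa_le (h : sa_part comm_subalgebra_unit) : anorm (phi h) <= anorm h.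
  apply/ler_addgt0Pr => e e0.
  have t0 : 0 <= anorm h + e by rewrite addr_ge0 ?anorm_ge0// ltW.
  set t := anorm h + e in t0 *.
  have : sa_norm (h ^+ 2) < t ^+ 2.
    have := @rnrm_sqr R (sa_cstar comm_subalgebra_unit) h; rewrite /= => ->.
    by rewrite /sa_norm /t; have := anorm_ge0 h; nra.
  move=> /(@sqrtB R (sa_cstar comm_subalgebra_unit))[/= k kP _].
  rewrite -(ler_pXn2r (n := 2)) ?nnegrE ?anorm_ge0//.
  have hk : phi (acomp h h) + phi (acomp k k) = (t ^+ 2)%:C *: idarr r.
    rewrite -phi1 -linear_Z// -linear_D//; congr phi.
    have := congr1 (@sa_val _ _ _ _ _) kP; rewrite expr2 /= => ->.
    by rewrite addrC subrK.
  have := @anorm_sqrD R T r (phi h) (phi k).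
  rewrite -!phistar !sa_star -!phiM hk => /(_ erefl erefl).
  have -> : acomp h k = acomp k h by exact: acomp_unitC.
  move=> /(_ erefl)/le_trans; apply.
  by rewrite anormZ ger0_norm ?exprn_ge0// ler_piMr ?exprn_ge0// anorm_id.
move=> a; rewrite -(ler_pXn2r (n := 2)) ?nnegrE ?anorm_ge0//.
rewrite -!anorm_cstar -phistar -phiM.
have sa_aa : acomp (astar a) a \in sa_pred comm_subalgebra_unit.
  by apply/sa_predP; rewrite astar_comp astarK.
exact: (sa_le (SaPart sa_aa)).
Qed.

(** For closedness: f (x) 1_r and 1_r (x) f depend contractively on f, so they differ by at most 2|f
    - g| when g is central. *)
Lemma central_comm_subalgebra :
  comm_subalgebra [set f : arr I I | f \in @central_pred R T].
Proof.
split=> /=.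
- exact: central_id.
- move=> z a b ca cb; apply: rpredD => //; exact: rpredZ.
- by move=> a b; exact: central_comp.
- by move=> a b _ _; exact: acomp_unitC.
rewrite closure_id; apply/seteqP; split; first exact: subset_closure.
move=> f /= clf; apply/mem_set => r.
apply/eqP; rewrite -subr_eq0; apply/eqP/anorm0_eq0/eqP.
rewrite eq_le anorm_ge0 andbT; apply/ler_addgt0Pr => e e0; rewrite add0r.
have e20 : 0 < (e / 2)%:C by rewrite ltcR divr_gt0.
have [g [/= /set_mem /(_ r) cg]] := clf _ (nbhsx_ballx f _ e20).
rewrite -ball_normE /= anormE ltcR => fg.
have := star_morphism_contractive (tens_idr_star_morphism r) (f - g).
have := star_morphism_contractive (tens_idl_star_morphism r) (f - g).
have subl (h : arr I I -> arr r r) : linear h -> h (f - g) = h f - h g.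
  by move=> hl; rewrite addrC -scaleN1r hl scaleN1r addrC.
rewrite (subl _ (tens_idr_linear r)) (subl _ (tens_idl_linear r)) cg.
have := anormD (tens_idr f r - tens_idl g r) (- (tens_idl f r - tens_idl g r)).
by rewrite anormN opprB addrA subrK; lra.
Qed.

Lemma central_star (f : arr I I) :
  f \in @central_pred R T -> astar f \in @central_pred R T.
Proof.
move=> /set_mem cf; apply/mem_set => r.
have [_ _ h1 _] := tens_idr_star_morphism r.
have [_ _ h2 _] := tens_idl_star_morphism r.
by rewrite h1 h2 cf.
Qed.

End TensorCategory.

(** * The spectrum *)

Lemma compact_set_type (X : topologicalType) (A : set X) :
  compact A -> compact [set: set_type A].
Proof.
move=> cA F FF _.
have [|p [Ap clp]] := cA (@set_val _ A @ F).
  by apply: (@filterS _ F _ setT) => [x _|]; [exact: set_valP|exact: filterT].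
exists (exist _ p (mem_set Ap)); split => // S U FS [_ [[V oV <-] /= Vp VU]].
have [|_ [[x Sx <-] Vx]] :=
  clp (set_val @` S) V _ (open_nbhs_nbhs (conj oV Vp)).
  by apply: (@filterS _ F _ S) => // x Sx; exists x.
by exists x; split => //; exact: VU.
Qed.

Lemma hausdorff_set_type (X : topologicalType) (A : set X) :
  hausdorff_space X -> hausdorff_space (set_type A).
Proof.
move=> hX p q clpq; apply: val_inj; apply: hX => U V Up Vq.
have [x [Ux Vx]] := clpq _ _ (@initial_continuous _ _ (@set_val _ A) p _ Up)
  (@initial_continuous _ _ (@set_val _ A) q _ Vq).
by exists (set_val x).
Qed.

(** * Topology of the complex plane *)

Section ComplexPlane.
Context (R : realType).

Lemma ReD (z w : R[i]) : complex.Re (z + w) = complex.Re z + complex.Re w.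
Proof. by case: z; case: w. Qed.

Lemma ReB (z w : R[i]) : complex.Re (z - w) = complex.Re z - complex.Re w.
Proof. by case: z; case: w. Qed.

Lemma ImB (z w : R[i]) : complex.Im (z - w) = complex.Im z - complex.Im w.
Proof. by case: z; case: w. Qed.

Lemma normc_ge_Im (z : R[i]) : `|complex.Im z|%:C <= `|z|.
Proof.
by rewrite normc_def lecR -sqrtr_sqr ler_wsqrtr// lerDr sqr_ge0.
Qed.

Lemma Re_continuous : continuous (@complex.Re R : Cplx R -> R).
Proof.
move=> z; have FF : Filter (nbhs (z : Cplx R)) by exact: nbhs_filter.
apply/cvgrPdist_lt => e e0.
have ec0 : 0 < e%:C by rewrite ltcR.
apply: filterS (nbhsx_ballx (z : Cplx R) _ ec0) => w.
rewrite -ball_normE /= -ltcR -ReB.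
by apply: le_lt_trans; exact: normc_ge_Re.
Qed.

Lemma Im_continuous : continuous (@complex.Im R : Cplx R -> R).
Proof.
move=> z; have FF : Filter (nbhs (z : Cplx R)) by exact: nbhs_filter.
apply/cvgrPdist_lt => e e0.
have ec0 : 0 < e%:C by rewrite ltcR.
apply: filterS (nbhsx_ballx (z : Cplx R) _ ec0) => w.
rewrite -ball_normE /= -ltcR -ImB.
by apply: le_lt_trans; exact: normc_ge_Im.
Qed.

Lemma real_complex_continuous : continuous (real_complex R : R -> Cplx R).
Proof.
move=> x; apply/cvgrPdist_lt => e e0.
have eE : e = (complex.Re e)%:C by rewrite RRe_real// gtr0_real.
have e0' : 0 < complex.Re e by rewrite -ltcR -eE.
apply: filterS (nbhsx_ballx x _ e0') => y.
rewrite -ball_normE /= -ltcR -eE -rmorphB.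
by rewrite normc_def /= expr0n addr0 sqrtr_sqr.
Qed.

(** These are the factors for Tychonoff's theorem. Boxes fit better than discs, as the real and
    imaginary parts of character values are bounded separately. *)
Lemma complex_box_compact (M : R) :
  compact [set z : Cplx R | `|complex.Re z| <= M /\ `|complex.Im z| <= M].
Proof.
pose f (p : R * R) : Cplx R := p.1%:C + 'i * p.2%:C.
have fE x y : f (x, y) = (x +i* y)%C by rewrite /f -complexiE /=; simpc.
have cf : continuous f.
  move=> p; apply: cvgD.
    by apply: continuous_comp; [exact: cvg_fst|exact: real_complex_continuous].
  apply: cvgM; first exact: cvg_cst.
  by apply: continuous_comp; [exact: cvg_snd|exact: real_complex_continuous].
have -> : [set z : Cplx R | `|complex.Re z| <= M /\ `|complex.Im z| <= M] =
    f @` (`[- M, M] `*` `[- M, M]).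
  apply/seteqP; split => [z [zr zi]|z [[x y]]] /=.
    exists (complex.Re z, complex.Im z).
      by rewrite /= !in_itv /= -!ler_norml.
    by rewrite fE; case: z {zr zi}.
  rewrite !in_itv /= -!ler_norml => -[xM yM] <-.
  by rewrite fE.
apply: continuous_compact; first exact: continuous_subspaceT.
by apply: compact_setX; exact: segment_compact.
Qed.

End ComplexPlane.

(** * Real and imaginary parts of endomorphisms *)

Section Cartesian.
Context (R : realType) (T : cstarCat R) (r : T).
Implicit Types a b x : arr r r.

Lemma half_sum (x : arr r r) : (2^-1 : R)%:C *: (x + x) = x.
Proof.
by rewrite scalerDr -scalerDl -rmorphD (_ : 2^-1 + 2^-1 = 1) ?scale1r//; lra.
Qed.

Lemma star_i_scale a : astar a = a -> astar ('i *: a) = - ('i *: a).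
Proof. by move=> sa; rewrite astarZ sa conjCi scaleNr. Qed.

Lemma cartesian_unique a b a' b' :
    astar a = a -> astar b = b -> astar a' = a' -> astar b' = b' ->
  a + 'i *: b = a' + 'i *: b' -> a = a' /\ b = b'.
Proof.
move=> sa sb sa' sb' E.
have re (u v : arr r r) : astar u = u -> astar v = v ->
    u = (2^-1 : R)%:C *: (u + 'i *: v + astar (u + 'i *: v)).
  move=> su sv; rewrite astarD su star_i_scale//.
  by rewrite addrACA subrr addr0 half_sum.
have aa : a = a' by rewrite (re a b)// (re a' b')// E.
split => //; move: E; rewrite aa => /addrI/(congr1 ( *:%R (- 'i))).
by rewrite !scalerA mulNr -expr2 sqrCi opprK !scale1r.
Qed.

Definition re_part x := (2^-1 : R)%:C *: (x + astar x).
Definition im_part x := (2^-1 : R)%:C *: ('i *: (astar x - x)).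

Lemma conjc_real (t : R) : (t%:C)^* = t%:C :> R[i].
Proof. by apply: CrealP; apply/complex_realP; exists t. Qed.

Lemma re_part_sa x : astar (re_part x) = re_part x.
Proof. by rewrite astarZ conjc_real astarD astarK addrC. Qed.

Lemma im_part_sa x : astar (im_part x) = im_part x.
Proof.
rewrite 2!astarZ conjc_real conjCi astarD astarN astarK.
by rewrite scaleNr -scalerN opprB.
Qed.

Lemma cartesian_decomposition x : x = re_part x + 'i *: im_part x.
Proof.
rewrite /im_part !scalerA mulrAC -expr2 sqrCi.
by rewrite mulN1r scaleNr -scalerN -scalerDr opprB addrACA subrr addr0 half_sum.
Qed.

End Cartesian.

(** * Characters on self-adjoint central elements *)

Section Spectrum.
Context (R : realType) (T : tensorCstarCat R).
Local Notation hC := (central_comm_subalgebra T).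
Local Notation B := (sa_cstar hC).
Implicit Types (f g : central T) (a b : sa_part hC) (chi : spectrum T).

Definition central_of b : central T := Central (sa_in b).

Lemma central_ofM a b :
  central_of (a * b) = central_mul (central_of a) (central_of b).
Proof. exact: val_inj. Qed.

Lemma central_ofD a b : central_of (a + b) = central_of a + central_of b.
Proof. exact: val_inj. Qed.

Lemma central_of_cst t : central_of (sa_cst hC t) = t%:C *: central1 T.
Proof. exact: val_inj. Qed.

Lemma central_decomposition f :
  exists a b, f = central_of a + 'i *: central_of b.
Proof.
have cs := central_star (centralP f).
have ca : re_part f \in sa_pred hC.
  apply/sa_predP; split; last exact: re_part_sa.
  by rewrite /= rpredZ ?rpredD//; exact: centralP.
have cb : im_part f \in sa_pred hC.
  apply/sa_predP; split; last exact: im_part_sa.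
  by rewrite /= !rpredZ ?rpredB//; exact: centralP.
exists (SaPart ca), (SaPart cb); apply: val_inj.
exact: cartesian_decomposition.
Qed.

Lemma central_decomposition_unique a b a' b' :
  central_of a + 'i *: central_of b = central_of a' + 'i *: central_of b' ->
  a = a' /\ b = b'.
Proof.
move=> /(congr1 (@central_val _ _)) /cartesian_unique[]; rewrite ?sa_star//.
by move=> aa bb; split; apply: val_inj.
Qed.

Lemma gelfand_fun_linear chi : linear (fun f => gelfand_fun f chi).
Proof. by have [] := set_valP chi. Qed.

Lemma gelfand_fun1 chi : gelfand_fun (central1 T) chi = 1.
Proof. by have [] := set_valP chi. Qed.

Lemma gelfand_funM chi f g :
  gelfand_fun (central_mul f g) chi = gelfand_fun f chi * gelfand_fun g chi.
Proof. by have [_ _] := set_valP chi; apply. Qed.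

Lemma gelfand_funD chi f g :
  gelfand_fun (f + g) chi = gelfand_fun f chi + gelfand_fun g chi.
Proof. exact: (linear_D (gelfand_fun_linear chi)). Qed.

Lemma gelfand_funZ chi (z : R[i]) f :
  gelfand_fun (z *: f) chi = z * gelfand_fun f chi.
Proof. exact: (linear_Z (gelfand_fun_linear chi)). Qed.

Lemma gelfand_fun_cst chi t : gelfand_fun (central_of (sa_cst hC t)) chi = t%:C.
Proof. by rewrite central_of_cst gelfand_funZ gelfand_fun1 mulr1. Qed.

(* If chi(b) = u + iv then (b - u)^2 + v^2 lies in the kernel of chi, although
   it is invertible for v <> 0. *)
Lemma gelfand_fun_sa_real chi b :
  complex.Im (gelfand_fun (central_of b) chi) = 0.
Proof.
set z := gelfand_fun _ _; apply: contrapT => /eqP v0.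
have v20 : 0 < complex.Im z ^+ 2 by rewrite exprn_even_gt0.
have [y /= yP] := rpos_inv v20 (@rpos_sqr R B (b - sa_cst hC (complex.Re z))).
have := congr1 (fun a => gelfand_fun (central_of a) chi) yP.
rewrite central_ofM gelfand_funM central_ofD gelfand_funD gelfand_fun_cst.
rewrite expr2 central_ofM gelfand_funM -rmorphN central_ofD gelfand_funD.
rewrite gelfand_fun_cst -/z.
have -> : central_of 1 = central1 T by exact: val_inj.
rewrite gelfand_fun1.
have -> : (z + (- complex.Re z)%:C) = 'i * (complex.Im z)%:C.
  rewrite -complexiE; case: (z) => u v; apply/eqP.
  by rewrite eq_complex /=; apply/andP; split; apply/eqP; ring.
rewrite mulrACA -!expr2 sqrCi rmorphXn mulN1r addNr mul0r => /eqP.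
by rewrite eq_sym oner_eq0.
Qed.

(** Taking the real part loses nothing, by [gelfand_fun_sa_real]. *)
Definition spectral_ev chi (b : B) : R :=
  complex.Re (gelfand_fun (central_of b) chi).

Lemma spectral_evE chi b :
  gelfand_fun (central_of b) chi = (spectral_ev chi b)%:C.
Proof.
rewrite /spectral_ev; have := gelfand_fun_sa_real chi b.
by case: (gelfand_fun _ _) => u v /= ->.
Qed.

Lemma spectral_ev_character chi : rcharacter (spectral_ev chi).
Proof.
split=> [t|a b|a b].
- by rewrite /spectral_ev gelfand_fun_cst.
- by rewrite /spectral_ev central_ofD gelfand_funD ReD.
- by rewrite {1}/spectral_ev central_ofM gelfand_funM !spectral_evE -rmorphM.
Qed.

Lemma gelfand_fun_decomposition chi a b :
  gelfand_fun (central_of a + 'i *: central_of b) chi =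
  (spectral_ev chi a +i* spectral_ev chi b)%C.
Proof.
by rewrite gelfand_funD gelfand_funZ !spectral_evE -complexiE; simpc.
Qed.

End Spectrum.

(** * Continuous complex functions and closures *)

Section CplxContinuity.
Context (R : realType) (X : topologicalType).
Implicit Types u v : X -> Cplx R.

Lemma continuous_cplx_cst (z : Cplx R) : continuous (fun _ : X => z).
Proof. by move=> x; exact: cvg_cst. Qed.

Lemma continuous_cplxD u v :
  continuous u -> continuous v -> continuous (fun x => u x + v x : Cplx R).
Proof. by move=> cu cv x; apply: cvgD; [exact: cu|exact: cv]. Qed.

Lemma continuous_cplxM u v :
  continuous u -> continuous v -> continuous (fun x => u x * v x : Cplx R).
Proof. by move=> cu cv x; apply: cvgM; [exact: cu|exact: cv]. Qed.

Lemma eq_on_closure u v (S : set X) : continuous u -> continuous v ->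
  (forall x, S x -> u x = v x) -> forall x, closure S x -> u x = v x.
Proof.
move=> cu cv uv x clx; apply/eqP; rewrite -subr_eq0; apply/eqP.
have cuv : continuous (fun x => u x - v x : Cplx R).
  by move=> y; apply: cvgB; [exact: cu|exact: cv].
have : closed ((fun x => u x - v x : Cplx R) @^-1` [set 0]).
  apply: preimage_closed => //.
  apply: accessible_closed_set1; apply: hausdorff_accessible.
  exact: (@norm_hausdorff _ (Cplx R)).
rewrite closure_id => H.
suff : ((fun x => u x - v x : Cplx R) @^-1` [set 0]) x by [].
by rewrite H; apply: closureS clx => y /uv /= ->; rewrite subrr.
Qed.

End CplxContinuity.

(** * Gelfand duality for the central elements *)

Section GelfandDuality.
Context (R : realType) (T : tensorCstarCat R).
Local Notation hC := (central_comm_subalgebra T).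
Local Notation B := (sa_cstar hC).

Lemma spectral_ev_continuous (b : B) :
  continuous (fun chi : spectrum T => spectral_ev chi b).
Proof.
move=> chi; apply: continuous_comp; last exact: Re_continuous.
exact: gelfand_fun_continuous.
Qed.

Lemma central_ofN (b : sa_part hC) : central_of (- b) = - central_of b.
Proof. exact: val_inj. Qed.

Lemma central_of0 : central_of (0 : sa_part hC) = 0.
Proof. exact: val_inj. Qed.

Lemma central_of1 : central_of (1 : sa_part hC) = central1 T.
Proof. exact: val_inj. Qed.

Lemma central_of_cstM t (b : sa_part hC) :
  central_of (sa_cst hC t * b) = t%:C *: central_of b.
Proof. by apply: val_inj; rewrite /= acompZl acomp1l. Qed.

Lemma central_mul_cartesian (a b a' b' : sa_part hC) :
  central_mul (central_of a + 'i *: central_of b)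
    (central_of a' + 'i *: central_of b') =
  central_of (a * a' - b * b') + 'i *: central_of (a * b' + b * a').
Proof.
apply: val_inj; rewrite /= !(acompDl, acompDr) !(acompZl, acompZr).
rewrite scalerA -expr2 sqrCi scaleN1r.
by rewrite [X in _ + X = _]addrC addrACA -scalerDr.
Qed.

(** Complexification: a + ib is sent to rho(a) + i rho(b). Norm estimates over real characters
    thereby become estimates over the spectrum. *)
Lemma rcharacter_extension (rho : B -> R) : rcharacter rho ->
  exists chi : spectrum T, forall b, spectral_ev chi b = rho b.
Proof.
move=> [rhoc rhoD rhoM].
have rhoN b : rho (- b) = - rho b.
  by apply/eqP; rewrite -addr_eq0 -rhoD addNr -(rmorph0 (@rcst R B)) rhoc.
have [re /choice[im reim]] := choice (@central_decomposition R T).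
(* Uniqueness of the Cartesian decomposition makes the chosen parts computable. *)
have reimU f a b : f = central_of a + 'i *: central_of b ->
    re f = a /\ im f = b.
  by move=> E; apply: central_decomposition_unique; rewrite -reim.
pose chi f : Cplx R := (rho (re f) +i* rho (im f))%C.
have chiE a b : chi (central_of a + 'i *: central_of b) = (rho a +i* rho b)%C.
  by rewrite /chi; have [-> ->] := reimU _ a b erefl.
have chiP : (@character R T) chi.
  split.
  - have chiD f g : chi (f + g) = chi f + chi g.
      rewrite (reim f) (reim g) addrACA -scalerDr -!central_ofD !chiE !rhoD.
      by [].
    have chiR (t : R) f : chi (t%:C *: f) = t%:C * chi f.
      rewrite (reim f) scalerDr scalerA mulrC -scalerA -!central_of_cstM.
      by rewrite !chiE !rhoM !rhoc; simpc.
    have chii f : chi ('i *: f) = 'i * chi f.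
      rewrite (reim f) scalerDr scalerA -expr2 sqrCi scaleN1r addrC.
      by rewrite -central_ofN !chiE rhoN -complexiE; simpc.
    move=> z f g; rewrite chiD; congr (_ + _).
    rewrite -[RHS]/(z * chi f : R[i]).
    have -> : z = (complex.Re z)%:C + 'i * (complex.Im z)%:C.
      by rewrite -complexiE; case: (z) => u v; simpc.
    by rewrite scalerDl chiD -scalerA chii !chiR mulrDl -mulrA.
  - rewrite -central_of1 -[central_of 1]addr0 -(scaler0 _ 'i) -central_of0.
    by rewrite chiE -(rmorph1 (@rcst R B)) -(rmorph0 (@rcst R B)) !rhoc.
  - move=> f g; rewrite (reim f) (reim g) central_mul_cartesian.
    by rewrite !chiE !rhoD rhoN !rhoM; simpc.
exists (exist _ chi (mem_set chiP)) => b.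
rewrite /spectral_ev -[gelfand_fun _ _]/(chi (central_of b)).
by rewrite -[central_of b]addr0 -(scaler0 _ 'i) -central_of0 chiE.
Qed.

(** Characters respect the involution automatically, being real on self-adjoint elements. *)
Lemma gelfand_fun_star (f : central T) (chi : spectrum T) :
  gelfand_fun (Central (central_star (centralP f))) chi = (gelfand_fun f chi)^*.
Proof.
have [a [b fab]] := central_decomposition f.
have -> : Central (central_star (centralP f)) =
    central_of a + 'i *: central_of (- b).
  apply: val_inj; rewrite /= fab /= astarD astarZ !sa_star conjCi.
  by rewrite scaleNr scalerN.
rewrite fab !gelfand_fun_decomposition.
have [evc evD _] := spectral_ev_character chi.
have -> : spectral_ev chi (- b) = - spectral_ev chi b.
  have ev0 : spectral_ev chi 0 = 0 by rewrite -(rmorph0 (@rcst R B)) evc.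
  by apply/eqP; rewrite -addr_eq0 -evD addNr ev0.
by [].
Qed.

Lemma spectrum_hausdorff : hausdorff_space (spectrum T).
Proof.
apply: hausdorff_set_type; apply: hausdorff_product => f.
exact: (@norm_hausdorff _ (Cplx R)).
Qed.

Lemma character_closed : closed (@character R T).
Proof.
have ev_cont f : continuous (fun p : {ptws central T -> Cplx R} => p f).
  exact: proj_continuous.
have cst_cont (z : Cplx R) :
    continuous (fun _ : {ptws central T -> Cplx R} => z).
  exact: continuous_cplx_cst.
rewrite closure_id; apply/seteqP; split; first exact: subset_closure.
move=> p clp; split.
- move=> z f g; apply: (eq_on_closure (ev_cont (z *: f + g))
    (continuous_cplxD (continuous_cplxM (cst_cont z) (ev_cont f)) (ev_cont g))
    _ clp).
  by move=> q [qlin _ _]; exact: qlin.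
- apply: (eq_on_closure (ev_cont (central1 T)) (cst_cont 1) _ clp).
  by move=> q [].
- move=> f g; apply: (eq_on_closure (ev_cont (central_mul f g))
    (continuous_cplxM (ev_cont f) (ev_cont g)) _ clp).
  by move=> q [_ _ qM]; exact: qM.
Qed.

(** Banach-Alaoglu by way of Tychonoff: the characters form a closed subset of a product of boxes,
    of sizes given by the norms of the self-adjoint components. *)
Lemma spectrum_compact : compact [set: spectrum T].
Proof.
apply: compact_set_type.
have bnd f : exists M, forall chi, (@character R T) chi ->
    `|complex.Re (chi f)| <= M /\ `|complex.Im (chi f)| <= M.
  have [a [b fab]] := central_decomposition f.
  exists (sa_norm a + sa_norm b) => chi /mem_set chiP.
  have -> : chi f = gelfand_fun f (exist _ chi chiP) by [].
  rewrite fab gelfand_fun_decomposition /=.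
  have := @rcharacter_norm R B _ a (spectral_ev_character (exist _ chi chiP)).
  have := @rcharacter_norm R B _ b (spectral_ev_character (exist _ chi chiP)).
  have := @rnrm_ge0 R B a; have := @rnrm_ge0 R B b.
  by rewrite /=; split; lra.
have [M MP] := choice bnd.
apply: (subclosed_compact character_closed
  (tychonoff (fun f => @complex_box_compact R (M f)))).
by move=> chi chiP f; exact: (MP f chi chiP).
Qed.

Lemma spectral_ev_separates (chi chi' : spectrum T) : chi <> chi' ->
  exists b, spectral_ev chi b <> spectral_ev chi' b.
Proof.
move=> chi_neq; apply: contrapT => H; apply: chi_neq; apply: val_inj.
apply/funext => f; have [a [b fab]] := central_decomposition f.
have E c : spectral_ev chi c = spectral_ev chi' c.
  by apply: contrapT => ne; apply: H; exists c.
rewrite -[LHS]/(gelfand_fun f chi) -[RHS]/(gelfand_fun f chi').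
by rewrite fab !gelfand_fun_decomposition !E.
Qed.

Lemma spectral_ev_norm (b : B) t : 0 <= t ->
  (forall chi : spectrum T, `|spectral_ev chi b| <= t) -> rnrm b <= t.
Proof.
move=> t0 bt; apply: rnrm_le_characters => // rho.
move=> /rcharacter_extension[chi chiE].
by rewrite -chiE.
Qed.

Lemma gelfand_injective : injective (@gelfand R T).
Proof.
move=> f g fg; have [a [b fab]] := central_decomposition f.
have [a' [b' gab]] := central_decomposition g.
have E chi : gelfand_fun f chi = gelfand_fun g chi.
  by have := congr1 (fun h => contFun_val h chi) fg.
have inj (c c' : B) :
    (forall chi, spectral_ev chi c = spectral_ev chi c') -> c = c'.
  move=> cc'; apply/eqP; rewrite -subr_eq0; apply/eqP/(@rnrm0_eq0 R B)/eqP.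
  rewrite eq_le rnrm_ge0 andbT; apply: spectral_ev_norm => // chi.
  have [_ evD _] := spectral_ev_character chi.
  have : spectral_ev chi (c - c') = 0.
    by have := evD (c - c') c'; rewrite subrK cc'; lra.
  by move=> ->; rewrite normr0.
rewrite fab gab; congr (central_of _ + 'i *: central_of _); apply: inj => chi;
  have := E chi; rewrite fab gab !gelfand_fun_decomposition => -[//].
Qed.

Lemma gelfand_surjective (h : contFun R[i] (spectrum T)) :
  exists f : central T, gelfand f = h.
Proof.
have ch : continuous (h : spectrum T -> Cplx R).
  exact: (set_mem (contFunP h)).
have surj := @ev_surjective R B (spectrum T) (@spectral_ev R T)
  spectrum_compact (@spectral_ev_character R T) spectral_ev_continuous
  spectral_ev_separates spectral_ev_norm.
have [|a aP] := surj (fun chi => complex.Re (h chi)).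
  by move=> chi; apply: continuous_comp; [exact: ch|exact: Re_continuous].
have [|b bP] := surj (fun chi => complex.Im (h chi)).
  by move=> chi; apply: continuous_comp; [exact: ch|exact: Im_continuous].
exists (central_of a + 'i *: central_of b).
apply: val_inj; apply/funext => chi /=.
by rewrite gelfand_fun_decomposition aP bP; case: (h chi).
Qed.

End GelfandDuality.

(** The second clause pins the action down: the function with Gelfand transform f acts by tensoring
    with f, which is what makes the structure natural. *)
Theorem proposition3p1 (R : realType) (T : tensorCstarCat R) :
  exists i : forall r : T, contFun R[i] (spectrum T) -> arr r r,
    is_tensor_CX_category i /\
    forall (f : central T) (r : T), i r (gelfand f) = tens_idr f r.
Proof.
have [inv invK] := choice (@gelfand_surjective R T).
have gelfandK f : inv (gelfand f) = f by apply: gelfand_injective; exact: invK.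
(* To show that [i r] respects an operation it then suffices to name a central element with the
   right Gelfand transform. *)
have invE f h : gelfand f = h -> inv h = f by move=> <-.
have gelfand_inv (h : contFun R[i] (spectrum T)) chi :
  gelfand_fun (inv h) chi = h chi by rewrite -[in RHS](invK h).
pose i r h := tens_idr (inv h) r.
exists i; split; last by move=> f r; rewrite /i gelfandK.
have ir f r s (t : arr r s) : acomp t (i r f) = acomp (i s f) t.
  exact: tens_idr_natural.
split.
  split => //; [exact: spectrum_compact|exact: spectrum_hausdorff|].
  move=> r; have [_ idrM idrS idr1] := tens_idr_star_morphism r.
  split.
  - move=> z f g; rewrite /i -tens_idr_linear; congr (tens_idr _ r).
    rewrite (invE (z *: inv f + inv g))//; apply: val_inj; apply/funext => chi.
    rewrite -{2}(invK f) -{2}(invK g).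
    by have [clin _ _] := set_valP chi; exact: clin.
  - move=> f g; rewrite /i -idrM; congr (tens_idr _ r).
    rewrite (invE (central_mul (inv f) (inv g)))//.
    apply: val_inj; apply/funext => chi.
    rewrite -{2}(invK f) -{2}(invK g); exact: gelfand_funM.
  - move=> f; rewrite /i -idrS; congr (tens_idr _ r).
    rewrite (invE (Central (central_star (centralP (inv f)))))//.
    apply: val_inj; apply/funext => chi.
    rewrite -[RHS]/((f chi)^*) -gelfand_inv; exact: gelfand_fun_star.
  - rewrite /i -idr1; congr (tens_idr _ r); rewrite (invE (central1 T))//.
    apply: val_inj; apply/funext => chi; exact: gelfand_fun1.
move=> r s r' s' t t' f; rewrite /CX_act; split.
  by rewrite -{1}[t']acomp1l tens_comp /i tens_tens_idr.
rewrite -{1}[t]acomp1l tens_comp /i.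
(* Centrality at s' turns f (x) 1 into 1 (x) f, associativity absorbs 1_s on the left, and
   centrality at s (x) s' turns the result back. *)
have cf := set_mem (centralP (inv f)).
by rewrite (cf s') tens_tens_idl -(cf (otens s s')).
Qed.
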